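(* Let $\bar H$ be a divisible ordinary Hodge $F$-crystal over $\bar A_0$ of level $\leq N$ with $N<p$, with filtrations $\bar U_\bullet$ and $\mathrm{Fil}^\bullet \bar H$. Then $$\bar H=\bigoplus_{i=0}^N \bar H^i,\qquad \bar H^i=\bar U_i\cap \mathrm{Fil}^i\bar H .$$ Moreover, writing $h^i=\mathrm{rank}\,\bar H^i$, there is an $\bar A$-basis $\{e_{im}\}_{0\leq i\leq N,\ 1\leq m\leq h^i}$ of $\bar H$ with $e_{im}\in\bar H^i$ for all $i,m$, and there is a matrix $\mathcal T$ with entries in $K^{\mathrm u}[[t_1,\ldots,t_n]]$, such that: (1) $\mathcal T=(\tau_{ij})_{0\leq i,j\leq N}$ is a block matrix with $\tau_{ij}$ of size $h^i\times h^j$, $\tau_{ij}=0$ for $j<i$, $\tau_{ii}$ is the identity matrix, and the constant term $\tau_{ij}(0)$ has entries in $p^{j-i}\bar W$ (for $j\ge i$); (2) the matrix of the connection $\nabla$ with respect to the basis $\{e_{im}\}$ is $\mathcal T^{-1}\cdot d\mathcal T$; (3) for every lift of Frobenius $\psi:\bar A\to\bar A$ the matrix of the map $F(\psi)\psi^*:\bar H\to\bar H$ with respect to the basis $\{e_{im}\}$ is $\mathcal T^{-1}\cdot P\cdot\psi(\mathcal T)$, where $P$ is the diagonal matrix $$P=\mathrm{diag}(1,\ldots,1,p,\ldots,p,\ldots,p^j,\ldots,p^j,\ldots,p^N,\ldots,p^N)$$ with the entry $p^j$ repeated $h^j$ times.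
   Context: Rings. $p$ is a prime, $\bar k$ an algebraically closed field of characteristic $p$, $\bar W$ its ring of Witt vectors, $K^{\mathrm u}=\bar W[1/p]$, $\sigma$ the Frobenius automorphism of $\bar W$ (lifting $x\mapsto x^p$ on $\bar k$), $\bar A_0=\bar k[[t_1,\ldots,t_n]]$, $\bar A=\bar W[[t_1,\ldots,t_n]]$. $\Omega^1_{\bar A/\bar W}$ denotes the module of (continuous) differentials, free over $\bar A$ on $dt_1,\ldots,dt_n$. A lift of Frobenius is a ring endomorphism $\phi$ of $\bar A$ that restricts to $\sigma$ on $\bar W$ and reduces modulo $p$ to $x\mapsto x^p$ on $\bar A_0$. For an $\bar A$-module $H$, $\phi^*H=\bar A\otimes_{\phi,\bar A}H$ and $\phi^*:H\to\phi^*H$, $h\mapsto 1\otimes h$, is $\phi$-linear. Crystals. A crystal over $\bar A_0$ is a finitely generated free $\bar A$-module $H$ with a connection $\nabla:H\to\Omega^1_{\bar A/\bar W}\otimes_{\bar A} H$ such that the operators $D_i=(\frac{d}{dt_i}\otimes1)\circ\nabla$ satisfy $D_iD_j=D_jD_i$ and $\lim_{m\to\infty}D_i^m=0$ in the $p$-adic topology of $\mathrm{End}_{\bar W}(H)$. For two lifts of Frobenius $\phi,\psi$ there is a canonical isomorphism $\chi(\phi,\psi):\phi^*H\to\psi^*H$ given by $$\chi(\phi,\psi)\phi^*(x)=\sum_{m_1,\ldots,m_n\ge0}\ \prod_{j=1}^n\frac{p^{m_j}}{m_j!}\Big(\frac{\phi(t_j)-\psi(t_j)}{p}\Big)^{m_j}\psi^*(D_1^{m_1}\circ\cdots\circ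 D_n^{m_n}(x)).$$ $F$-crystals. An $F$-crystal over $\bar A_0$ is a crystal $(H,\nabla)$ together with, for every lift of Frobenius $\phi$, an $\bar A$-linear map $F(\phi):\phi^*H\to H$ such that: $\nabla\circ F(\phi)\phi^*=(\phi\otimes F(\phi)\phi^* )\circ\nabla$, where $\phi(b\,da)=\phi(b)\,d(\phi(a))$ on forms; $F(\psi)\circ\chi(\phi,\psi)=F(\phi)$ for all lifts $\phi,\psi$; and $F(\phi)\otimes\mathbb Q_p$ is an isomorphism. It is a unit $F$-crystal if $F(\phi)$ is an isomorphism for one (equivalently every) $\phi$. For a unit $F$-crystal $V$, the Tate twist $V(-i)$ is the same module with connection, with $F(\phi)\phi^*$ replaced by $p^iF(\phi)\phi^*$. Filtrations. Let $H_0=H\otimes_{\bar A}\bar A_0$. Put $\mathrm{Fil}_iH_0=\{x\in H_0\mid \exists y\in H\text{ lifting }x\text{ with }p^iy\in\mathrm{Im}\,F(\phi)\}$ (conjugate filtration, increasing) and $\mathrm{Fil}^iH_0=\{x\in H_0\mid\exists y\in H\text{ lifting }x\text{ with }F(\phi)\phi^*y\in p^iH\}$ (Hodge filtration, decreasing); these are independent of $\phi$. $H$ is of level $\le N$ if $\mathrm{Fil}_NH_0=H_0$ and $\mathrm{Fil}^{N+1}H_0=0$. $\mathrm{gr}_\bullet H_0$ is the graded module of the conjugate filtration. A Hodge $F$-crystal over $\bar A_0$ is an $F$-crystal $H$ with a decreasing filtration $H=\mathrm{Fil}^0H\supset\mathrm{Fil}^1H\supset\cdots$ by free $\bar A$-submodules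 such that for all $i$: $\mathrm{Fil}^iH\otimes_{\bar A}\bar A_0=\mathrm{Fil}^iH_0$ (via the natural map to $H_0$) and $\nabla\mathrm{Fil}^iH\subset\Omega^1_{\bar A/\bar W}\otimes\mathrm{Fil}^{i-1}H$ (Griffiths transversality). An $F$-crystal $H$ is ordinary if $\mathrm{gr}_\bullet H_0$ is a free $\bar A_0$-module and $H_0=\mathrm{Fil}_iH_0\oplus\mathrm{Fil}^{i+1}H_0$ for every $i$. An ordinary $F$-crystal has a unique filtration by sub-$F$-crystals $0=U_{-1}\subset U_0\subset U_1\subset\cdots$ with $U_i\otimes_{\bar A}\bar A_0=\mathrm{Fil}_iH_0$ and $U_i/U_{i-1}\simeq V_i(-i)$ for unit $F$-crystals $V_i$; for $H=\bar H$ it is denoted $\bar U_\bullet$. A Hodge $F$-crystal $\bar H$ with Hodge filtration $\{\mathrm{Fil}^i\bar H\}_{0\le i\le N}$ is divisible if for some lift of Frobenius $\phi$ one has $F(\phi)\phi^*\mathrm{Fil}^i\bar H\subset p^i\bar H$ for $i=0,\ldots,N$ (if $p>N$ this then holds for every lift of Frobenius). Matrix conventions. The basis $\{e_{im}\}$ is ordered by $i$ first, then $m$. Columns of matrices give images of basis vectors: $\nabla e_b=\sum_a M_{ab}\otimes e_a$ and $F(\psi)\psi^*e_b=\sum_a M_{ab}e_a$. For a matrix over $K^{\mathrm u}[[t_1,\ldots,t_n]]$, $d$ is applied entrywise, $(0)$ denotes constant term, and $\psi(\mathcal T)$ is obtained by applying $\psi$ to the entries, i.e. applying $\sigma$ to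 the coefficients and substituting $\psi(t_i)$ for $t_i$ (the resulting sums converging $p$-adically coefficient by coefficient). *)

(* Defs.v *)
From HB Require Import structures.
From mathcomp Require Import all_boot all_order all_algebra.
From mathcomp Require Import fraction mpoly boolp.
Set Implicit Arguments.
Unset Strict Implicit.
Unset Printing Implicit Defensive.
Import GRing.Theory.
Local Open Scope ring_scope.
Local Open Scope quotient_scope.

Notation "x %:F" := (@FracField.tofrac _ x) : ring_scope.

(* Formal power series R[[t_1, ..., t_n]]: all functions from multi-indices
   to R, with the Cauchy product. *)

Record mps (n : nat) (R : Type) := MPS { mpscoef :> 'X_{1..n} -> R }.

Notation "{ 'mps' R [ n ] }" := (mps n R)
  (at level 0, R at level 2, n at level 2, format "{ 'mps'  R [ n ] }")
  : type_scope.

HB.instance Definition _ n (R : Type) := gen_eqMixin {mps R[n]}.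
HB.instance Definition _ n (R : Type) := gen_choiceMixin {mps R[n]}.

Lemma mpsP n (R : Type) (f g : {mps R[n]}) :
  (forall m, f m = g m) <-> f = g.
Proof.
split=> [|-> //]; case: f g => f [g] /= fg.
by congr MPS; apply/funext.
Qed.

Section SeriesZmod.
Variables (n : nat) (R : zmodType).
Implicit Types f g : {mps R[n]}.

Definition mps_zero : {mps R[n]} := MPS (fun=> 0).
Definition mps_opp f : {mps R[n]} := MPS (fun m => - f m).
Definition mps_add f g : {mps R[n]} := MPS (fun m => f m + g m).

Fact mps_addA : associative mps_add.
Proof. by move=> f g h; apply/mpsP=> m /=; rewrite addrA. Qed.
Fact mps_addC : commutative mps_add.
Proof. by move=> f g; apply/mpsP=> m /=; rewrite addrC. Qed.
Fact mps_add0 : left_id mps_zero mps_add.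
Proof. by move=> f; apply/mpsP=> m /=; rewrite add0r. Qed.
Fact mps_addN : left_inverse mps_zero mps_opp mps_add.
Proof. by move=> f; apply/mpsP=> m /=; rewrite addNr. Qed.

HB.instance Definition _ :=
  GRing.isZmodule.Build {mps R[n]} mps_addA mps_addC mps_add0 mps_addN.

Lemma mps0E m : (0 : {mps R[n]}) m = 0. Proof. by []. Qed.
Lemma mpsDE f g m : (f + g) m = f m + g m. Proof. by []. Qed.
Lemma mpsNE f m : (- f) m = - f m. Proof. by []. Qed.
Lemma mpsMnE f m q : (f *+ q) m = f m *+ q.
Proof. by elim: q => // q IH; rewrite !mulrS mpsDE IH. Qed.

End SeriesZmod.

Section SeriesRing.
Variables (n : nat) (R : comNzRingType).
Implicit Types f g h : {mps R[n]}.

Definition mps_one : {mps R[n]} := MPS (fun m => (m == 0%MM)%:R).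
Definition mps_mul f g : {mps R[n]} :=
  MPS (fun m => \sum_(k : 'X_{1..n < (mdeg m).+1} | (k <= m)%MM)
                   f k * g (m - k)%MM).

Definition mps_trunc (d : nat) f : {mpoly R[n]} :=
  \sum_(k : 'X_{1..n < d}) f k *: 'X_[k].

Lemma mps_truncE d f m : (mdeg m < d)%N -> (mps_trunc d f)@_m = f m.
Proof. exact: mcoeff_mpoly. Qed.

Lemma mpoly_mul_eqdeg d (p1 p2 q1 q2 : {mpoly R[n]}) :
    (forall m, (mdeg m < d)%N -> p1@_m = p2@_m) ->
    (forall m, (mdeg m < d)%N -> q1@_m = q2@_m) ->
  forall m, (mdeg m < d)%N -> (p1 * q1)@_m = (p2 * q2)@_m.
Proof.
move=> ep eq m md; rewrite !(mcoeff_poly_mul_lin _ _ md).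
apply: eq_bigr => k _; rewrite ep ?bmdeg // eq //.
exact: leq_ltn_trans (mdegB _ _) md.
Qed.

Lemma mps_mul_trunc d f g m : (mdeg m < d)%N ->
  (mps_mul f g) m = (mps_trunc d f * mps_trunc d g)@_m.
Proof.
move=> md; rewrite (mcoeff_poly_mul_lin _ _ (leqnn (mdeg m).+1)) /=.
apply: eq_bigr => k _; rewrite !mps_truncE //.
  exact: leq_ltn_trans (mdegB _ _) md.
exact: leq_trans (bmdeg k) md.
Qed.

Lemma mps_trunc_mul d f g m : (mdeg m < d)%N ->
  (mps_trunc d (mps_mul f g))@_m = (mps_trunc d f * mps_trunc d g)@_m.
Proof. by move=> md; rewrite mps_truncE // (mps_mul_trunc _ _ md). Qed.

Fact mps_mulA : associative mps_mul.
Proof.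
move=> f g h; apply/mpsP=> m; have md := leqnn (mdeg m).+1.
rewrite !(mps_mul_trunc _ _ md).
rewrite (mpoly_mul_eqdeg (fun _ _ => erefl) (@mps_trunc_mul _ g h) md).
rewrite (mpoly_mul_eqdeg (@mps_trunc_mul _ f g) (fun _ _ => erefl) md).
by rewrite mulrA.
Qed.

Fact mps_mulC : commutative mps_mul.
Proof.
move=> f g; apply/mpsP=> m; have md := leqnn (mdeg m).+1.
by rewrite !(mps_mul_trunc _ _ md) mulrC.
Qed.

Fact mps_mul1 : left_id mps_one mps_mul.
Proof.
move=> f; apply/mpsP=> m; have md := leqnn (mdeg m).+1.
rewrite (mps_mul_trunc _ _ md).
rewrite (@mpoly_mul_eqdeg _ _ 1 _ _ _ (fun _ _ => erefl) _ md).
  by rewrite mul1r mps_truncE.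
by move=> l ld; rewrite mps_truncE // mcoeff1.
Qed.

Fact mps_mulDl : left_distributive mps_mul +%R.
Proof.
move=> f g h; apply/mpsP=> m /=; rewrite -big_split /=.
by apply: eq_bigr => k _; rewrite mulrDl.
Qed.

Fact mps_oner_neq0 : mps_one != 0.
Proof.
apply/eqP=> /mpsP /(_ 0%MM) /eqP.
by rewrite /= eqxx oner_eq0.
Qed.

HB.instance Definition _ := GRing.Zmodule_isComNzRing.Build {mps R[n]}
  mps_mulA mps_mulC mps_mul1 mps_mulDl mps_oner_neq0.

Lemma mps1E m : (1 : {mps R[n]}) m = (m == 0%MM)%:R. Proof. by []. Qed.
Lemma mpsME f g m :
  (f * g) m = \sum_(k : 'X_{1..n < (mdeg m).+1} | (k <= m)%MM)
                 f k * g (m - k)%MM.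
Proof. by []. Qed.

Definition mps_unit : {pred {mps R[n]}} := fun f => `[< exists g, g * f = 1 >].
Definition mps_inv f : {mps R[n]} :=
  if pselect (exists g, g * f = 1) is left e then sval (cid e) else f.

Fact mps_mulVx : {in mps_unit, left_inverse 1 mps_inv *%R}.
Proof.
move=> f /asboolP uf; rewrite /mps_inv.
by case: pselect => // e; case: (cid e).
Qed.
Fact mps_unitPl f g : g * f = 1 -> mps_unit f.
Proof. by move=> gf; apply/asboolP; exists g. Qed.
Fact mps_inv_out : {in [predC mps_unit], mps_inv =1 id}.
Proof.
move=> f nuf; rewrite /mps_inv; case: pselect => // e.
by case/negP: nuf; apply/asboolP.
Qed.

HB.instance Definition _ := GRing.ComNzRing_hasMulInverse.Build {mps R[n]}
  mps_mulVx mps_unitPl mps_inv_out.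

Definition mpsC (a : R) : {mps R[n]} := MPS (fun m => a *+ (m == 0%MM)).
Definition mpsX (i : 'I_n) : {mps R[n]} := MPS (fun m => (m == U_(i)%MM)%:R).
(* d/dt_i *)
Definition mps_deriv (i : 'I_n) f : {mps R[n]} :=
  MPS (fun m => f (m + U_(i))%MM *+ (m i).+1).

End SeriesRing.

Definition mps_map n (R S : Type) (g : R -> S) (f : {mps R[n]}) : {mps S[n]} :=
  MPS (fun m => g (f m)).

(* The quotient x / d when d divides x, and 0 otherwise; it is only used for
   d not a zero divisor. *)
Definition exact_quot (R : comNzRingType) (x d : R) : R :=
  if pselect (exists q, x = d * q) is left e then sval (cid e) else 0.

(* Unconditional convergence of a family indexed by multi-indices, for the
   linear topology in which nbh N is the N-th neighbourhood of 0. *)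
Definition has_sum n (E : zmodType) (nbh : nat -> E -> Prop)
    (u : 'X_{1..n} -> E) (s : E) : Prop :=
  forall N : nat, exists d : nat, forall S : seq 'X_{1..n},
    uniq S -> (forall m, (mdeg m < d)%N -> m \in S) ->
    nbh N (s - \sum_(m <- S) u m).

Section Modules.
Variables (R : comNzRingType) (M : lmodType R).

Definition is_submodule (P : M -> Prop) : Prop :=
  P 0 /\ forall (a : R) x y, P x -> P y -> P (a *: x + y).

Definition is_basis_of (I : finType) (P : M -> Prop) (b : I -> M) : Prop :=
  (forall i, P (b i)) /\
  forall x, P x -> exists! a : {ffun I -> R}, x = \sum_i a i *: b i.

Definition is_basis (I : finType) (b : I -> M) : Prop :=
  is_basis_of (fun=> True) b.

Definition has_rank (P : M -> Prop) (r : nat) : Prop :=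
  is_submodule P /\ exists b : 'I_r -> M, is_basis_of P b.

Definition is_free_sub (P : M -> Prop) : Prop := exists r, has_rank P r.

(* For submodules Q <= P, the quotient P / Q is free of finite rank. *)
Definition is_free_quot (P Q : M -> Prop) : Prop :=
  exists (r : nat) (b : 'I_r -> M), (forall i, P (b i)) /\
  forall x, P x ->
    exists! a : {ffun 'I_r -> R}, Q (x - \sum_i a i *: b i).

Definition is_direct_sum2 (P Q : M -> Prop) : Prop :=
  forall x, exists! yz : M * M, [/\ P yz.1, Q yz.2 & x = yz.1 + yz.2].

Definition is_direct_sum (I : finType) (P : I -> M -> Prop) : Prop :=
  forall x, exists! y : {ffun I -> M},
    (forall i, P i (y i)) /\ x = \sum_i y i.

Definition in_pow (q : nat) (i : nat) (x : M) : Prop :=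
  exists y, x = (q%:R ^+ i) *: y.

(* The columns of A are the images of the vectors of the family b. *)
Definition is_matrix_of r (b : 'I_r -> M) (f : M -> M) (A : 'M[R]_r) : Prop :=
  forall j, f (b j) = \sum_i A i j *: b i.

End Modules.

(* The Witt vectors of k, as the strict p-ring with residue ring k (Serre,
   Local Fields, II.5): p is not a zero divisor, W is separated and complete
   for the p-adic topology, and W / pW = k.  It is determined by k up to a
   unique isomorphism over k; since k is a field, it is a domain.  The
   Frobenius automorphism is likewise the unique one lifting x |-> x ^ p. *)
Record witt_ring (p : nat) (k : closedFieldType) := WittRing {
  witt_car :> idomainType;
  wres : {rmorphism witt_car -> k};
  wfrob : {rmorphism witt_car -> witt_car};
  wres_surj : forall a : k, exists w, wres w = a;
  wres_ker : forall w, wres w = 0 <-> exists v, w = p%:R * v;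
  witt_ptorsion_free : forall w : witt_car, p%:R * w = 0 -> w = 0;
  witt_complete : forall u : nat -> witt_car,
    exists! s, forall N, exists v,
      s - \sum_(i < N) u i * p%:R ^+ i = p%:R ^+ N * v;
  wfrob_bij : bijective wfrob;
  wfrob_lift : forall w, wres (wfrob w) = wres w ^+ p
}.

Section Crystals.
Variables (p n : nat) (k : closedFieldType) (W : witt_ring p k).

Local Notation A := {mps W[n]}.
Local Notation A0 := {mps k[n]}.
(* W[1/p], which is the whole fraction field of W: every nonzero element of W
   is a power of p times a unit. *)
Local Notation Ku := {fraction W}.

Definition redA : A -> A0 := mps_map (wres W).

Record frob_lift := FrobLift {
  lift_mor :> {rmorphism A -> A};
  lift_const : forall w : W, lift_mor (mpsC n w) = mpsC n (wfrob W w);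
  lift_modp : forall f : A, redA (lift_mor f) = redA f ^+ p
}.

(* H_0 = H \otimes_A A_0 = H / pH with its A_0-module structure *)
Section Reduction.
Variable H : lmodType A.

Definition pmul_pred : {pred H} := fun x => `[< in_pow p 1 x >].

Fact pmul_zmod_closed : zmod_closed pmul_pred.
Proof.
split; first by apply/asboolP; exists 0; rewrite scaler0.
move=> x y /asboolP[x' ->] /asboolP[y' ->]; apply/asboolP.
by exists (x' - y'); rewrite scalerBr.
Qed.
HB.instance Definition _ :=
  GRing.isZmodClosed.Build H pmul_pred pmul_zmod_closed.

Definition H0 : Type := {ideal_quot pmul_pred}.
HB.instance Definition _ := GRing.Zmodule.on H0.

Definition red (x : H) : H0 := \pi_({ideal_quot pmul_pred}) x.

Lemma redB x y : red (x - y) = red x - red y.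
Proof. exact: (raddfB (\pi_({ideal_quot pmul_pred}))). Qed.

Lemma redD x y : red (x + y) = red x + red y.
Proof. exact: (raddfD (\pi_({ideal_quot pmul_pred}))). Qed.

Lemma red_eq x y : red x = red y <-> exists z, x - y = p%:R *: z.
Proof.
have -> : (red x = red y) <-> (x - y \in pmul_pred).
  by rewrite Quotient.idealrBE; split=> /eqP.
by split=> [/asboolP[z ->]|[z e]]; [|apply/asboolP]; exists z;
  rewrite ?expr1 // expr1.
Qed.

Lemma red_surj (x0 : H0) : exists x, red x = x0.
Proof. by exists (repr (x0 : {ideal_quot pmul_pred})); rewrite /red reprK. Qed.

Definition repH (x0 : H0) : H := sval (cid (red_surj x0)).
Lemma repHK x0 : red (repH x0) = x0.
Proof. exact: svalP (cid (red_surj x0)). Qed.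

Definition repA (a0 : A0) : A :=
  MPS (fun m => sval (cid (wres_surj W (a0 m)))).
Lemma repAK a0 : redA (repA a0) = a0.
Proof.
apply/mpsP => m /=; exact: svalP (cid (wres_surj W (a0 m))).
Qed.

Lemma mps_pmul (f : A) m : (p%:R * f) m = p%:R * f m.
Proof. by rewrite !mulr_natl mpsMnE. Qed.

Lemma redA_eq (a b : A) : redA a = redA b -> exists c, a - b = p%:R * c.
Proof.
move=> /mpsP ab.
have ex m : exists v, (a - b) m = p%:R * v.
  apply/wres_ker; rewrite mpsDE mpsNE rmorphB.
  by have /= -> := ab m; rewrite subrr.
exists (MPS (fun m => sval (cid (ex m)))); apply/mpsP => m.
by rewrite mps_pmul /=; exact: svalP (cid (ex m)).
Qed.

Lemma redAD (a b : A) : redA (a + b) = redA a + redA b.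
Proof. by apply/mpsP => m /=; rewrite rmorphD. Qed.
Lemma redAM (a b : A) : redA (a * b) = redA a * redA b.
Proof.
apply/mpsP => m /=; rewrite rmorph_sum; apply: eq_bigr => l _.
by rewrite rmorphM.
Qed.
Lemma redA1 : redA 1 = 1.
Proof. by apply/mpsP => m /=; rewrite rmorph_nat. Qed.

Lemma red_scale_eq (a b : A) x y :
  redA a = redA b -> red x = red y -> red (a *: x) = red (b *: y).
Proof.
move=> /redA_eq[c ab] /red_eq[z xy]; apply/red_eq.
exists (c *: x + b *: z).
rewrite scalerDr !scalerA -ab [p%:R * b]mulrC -scalerA -xy.
by rewrite scalerBl scalerBr addrA subrK.
Qed.

Definition scale0 (a0 : A0) (x0 : H0) : H0 := red (repA a0 *: repH x0).

Lemma red_scale (a : A) x : red (a *: x) = scale0 (redA a) (red x).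
Proof. by apply: red_scale_eq; rewrite ?repAK ?repHK. Qed.

Fact scale0A a b x : scale0 a (scale0 b x) = scale0 (a * b) x.
Proof.
by rewrite -[a]repAK -[b]repAK -[x]repHK -redAM -!red_scale scalerA.
Qed.
Fact scale01 : left_id 1 scale0.
Proof. by move=> x; rewrite -redA1 -[x]repHK -red_scale scale1r. Qed.
Fact scale0Dr : right_distributive scale0 +%R.
Proof.
move=> a x y; rewrite -[a]repAK -[x]repHK -[y]repHK.
by rewrite -redD -!red_scale scalerDr redD.
Qed.
Fact scale0Dl x : {morph scale0^~ x : a b / a + b}.
Proof.
move=> a b; rewrite -[a]repAK -[b]repAK -[x]repHK.
by rewrite -redAD -!red_scale scalerDl redD.
Qed.
HB.instance Definition _ := GRing.Zmodule_isLmodule.Build A0 H0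
  scale0A scale01 scale0Dr scale0Dl.

End Reduction.

(* Underlying data of an F-crystal.
   - conn x i is the coefficient D_i x of dt_i in nabla x, the module of
     differentials being free on the dt_i;
   - frob phi is the phi-linear map F(phi) \o phi^* from H to H, which
     determines, and is determined by, the linear map F(phi) on phi^* H. *)
Record fcrystal_data (H : lmodType A) := FCrystalData {
  conn : H -> {ffun 'I_n -> H};
  frob : frob_lift -> H -> H
}.

Definition is_connection (H : lmodType A) (D : H -> {ffun 'I_n -> H}) :=
  (forall x y, D (x + y) = D x + D y) /\
  forall (a : A) x i, D (a *: x) i = mps_deriv i a *: x + a *: D x i.

Definition is_crystal (H : lmodType A) (D : H -> {ffun 'I_n -> H}) : Prop :=
  [/\ exists (r : nat) (b : 'I_r -> H), is_basis b,
      is_connection D,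
      forall i j x, D (D x j) i = D (D x i) j
    & forall i N, exists M, forall m, (M <= m)%N ->
        forall x, in_pow p N (iter m (fun y => D y i) x)].

(* D_1^{m_1} \o ... \o D_n^{m_n} *)
Definition conn_iter (H : lmodType A) (D : H -> {ffun 'I_n -> H})
    (m : 'X_{1..n}) (x : H) : H :=
  foldr (fun i y => iter (m i) (fun z => D z i) y) x (enum 'I_n).

Definition chi_coef (phi psi : frob_lift) (m : 'X_{1..n}) : A :=
  \prod_(j < n)
    (mpsC n (exact_quot (p%:R ^+ m j) ((m j)`!)%:R) *
     exact_quot (phi (mpsX W j) - psi (mpsX W j)) p%:R ^+ m j).

(* F(phi) : phi^* H -> H in coordinates, for a basis b of H:  phi^* H has
   basis 1 \otimes b i, mapped to frob phi (b i). *)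
Definition frob_lin (H : lmodType A) (c : fcrystal_data H) (phi : frob_lift)
    r (b : 'I_r -> H) (a : {ffun 'I_r -> A}) : H :=
  \sum_i a i *: frob c phi (b i).

(* F(phi) \otimes Q_p is bijective: the kernel and the cokernel of F(phi) are
   killed, elementwise, by powers of p. *)
Definition is_isogeny (H : lmodType A) (c : fcrystal_data H)
    (phi : frob_lift) : Prop :=
  forall r (b : 'I_r -> H), is_basis b ->
    (forall a, frob_lin c phi b a = 0 ->
       exists s, forall i, p%:R ^+ s * a i = 0) /\
    (forall y, exists s a, frob_lin c phi b a = p%:R ^+ s *: y).

Definition is_fcrystal (H : lmodType A) (c : fcrystal_data H) : Prop :=
  [/\ is_crystal (conn c),
      forall phi (a : A) x y,
        frob c phi (a *: x + y) = phi a *: frob c phi x + frob c phi y,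
      (* nabla (F phi^* x) = (phi \otimes F phi^* ) (nabla x), where
         phi (dt_j) = \sum_i d(phi t_j)/dt_i dt_i *)
      forall phi x i, conn c (frob c phi x) i =
        \sum_(j < n) mps_deriv i (phi (mpsX W j)) *: frob c phi (conn c x j),
      (* F(psi) \o chi(phi, psi) = F(phi), evaluated on phi^* x *)
      forall phi psi x,
        has_sum (@in_pow _ H p)
          (fun m => chi_coef phi psi m *:
                      frob c psi (conn_iter (conn c) m x))
          (frob c phi x)
    & forall phi, is_isogeny c phi].

Definition is_unit_fcrystal (H : lmodType A) (c : fcrystal_data H) : Prop :=
  is_fcrystal c /\
  exists phi, forall r (b : 'I_r -> H), is_basis b ->
    bijective (frob_lin c phi b).

(* V(-i) *)
Definition tate_twist (V : lmodType A) (c : fcrystal_data V) (i : nat) :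
    fcrystal_data V :=
  FCrystalData (conn c) (fun phi x => p%:R ^+ i *: frob c phi x).

(* A submodule P with an F-crystal structure for which the inclusion is
   compatible with connections and Frobenii. *)
Definition is_sub_fcrystal (H : lmodType A) (c : fcrystal_data H)
    (P : H -> Prop) : Prop :=
  exists (V : lmodType A) (cV : fcrystal_data V) (j : {linear V -> H}),
    [/\ is_fcrystal cV, injective j, forall x, P x <-> exists v, j v = x,
        forall v i, conn c (j v) i = j (conn cV v i)
      & forall phi v, frob c phi (j v) = j (frob cV phi v)].

(* An isomorphism of P / Q with V, for sub-F-crystals Q <= P of H; it is given
   by a map q of which only the restriction to P matters. *)
Definition is_quot_iso (H : lmodType A) (c : fcrystal_data H)
    (P Q : H -> Prop) (V : lmodType A) (cV : fcrystal_data V) : Prop :=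
  exists q : H -> V,
    [/\ forall (a : A) x y, P x -> P y -> q (a *: x + y) = a *: q x + q y,
        forall v, exists2 x, P x & q x = v,
        forall x, P x -> (q x = 0 <-> Q x),
        forall x i, P x -> q (conn c x i) = conn cV (q x) i
      & forall phi x, P x -> q (frob c phi x) = frob cV phi (q x)].

(* The natural map P \otimes A_0 = P / pP -> H_0 is an isomorphism onto P0. *)
Definition reduces_to (H : lmodType A) (P : H -> Prop) (P0 : H0 H -> Prop) :=
  (forall x0, P0 x0 <-> exists2 x, P x & red x = x0) /\
  (forall x, P x -> red x = 0 -> exists2 y, P y & x = p%:R *: y).

Section Filtrations.
Variables (H : lmodType A) (c : fcrystal_data H).
(* The lift with which the conjugate and Hodge filtrations of H_0 are
   computed; they do not depend on it. *)
Variable phi : frob_lift.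

(* The image of F(phi) is the submodule spanned by that of frob phi. *)
Definition im_frob (x : H) : Prop :=
  exists (r : nat) (a : 'I_r -> A) (y : 'I_r -> H),
    x = \sum_i a i *: frob c phi (y i).

Definition conj_fil (i : nat) (x0 : H0 H) : Prop :=
  exists2 y, red y = x0 & im_frob (p%:R ^+ i *: y).

Definition hodge_fil (i : nat) (x0 : H0 H) : Prop :=
  exists2 y, red y = x0 & in_pow p i (frob c phi y).

Definition level_le (N : nat) : Prop :=
  (forall x0, conj_fil N x0) /\ (forall x0, hodge_fil N.+1 x0 -> x0 = 0).

(* The step i - 1 of an increasing filtration whose step -1 is 0. *)
Definition prev_step (M : zmodType) (F : nat -> M -> Prop) (i : nat) :=
  if i is j.+1 then F j else fun x => x = 0.

Definition is_ordinary : Prop :=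
  (forall i, is_free_quot (conj_fil i) (prev_step conj_fil i)) /\
  (forall i, is_direct_sum2 (conj_fil i) (hodge_fil i.+1)).

Definition is_ordinary_filtration (U : nat -> H -> Prop) : Prop :=
  [/\ forall i, is_sub_fcrystal c (U i),
      forall i x, U i x -> U i.+1 x,
      forall i, reduces_to (U i) (conj_fil i)
    & forall i, exists (V : lmodType A) (cV : fcrystal_data V),
        is_unit_fcrystal cV /\
        is_quot_iso c (U i) (prev_step U i) (tate_twist cV i)].

Definition is_hodge_filtration (Fil : nat -> H -> Prop) : Prop :=
  [/\ forall x, Fil 0 x,
      forall i x, Fil i.+1 x -> Fil i x,
      forall i, is_free_sub (Fil i),
      forall i, reduces_to (Fil i) (hodge_fil i)
    & forall i x j, Fil i.+1 x -> Fil i (conn c x j)].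

End Filtrations.

Definition is_divisible (H : lmodType A) (c : fcrystal_data H)
    (Fil : nat -> H -> Prop) (N : nat) : Prop :=
  exists phi : frob_lift, forall i, (i <= N)%N ->
    forall x, Fil i x -> in_pow p i (frob c phi x).

(* sigma extended to W[1/p] *)
Definition frobK (x : Ku) : Ku :=
  (wfrob W \n_(repr x))%:F / (wfrob W \d_(repr x))%:F.

Definition embK : A -> {mps Ku[n]} := mps_map (@FracField.tofrac W).

(* All coefficients are of the form w / p^s with w in W. *)
Definition over_Wp (f : {mps Ku[n]}) : Prop :=
  forall m, exists (w : W) (s : nat), f m = w%:F / p%:R ^+ s.

(* g = psi(f): each coefficient of g is the p-adically convergent sum over l of
   the corresponding coefficients of sigma(f_l) psi(t)^l. *)
Definition is_subst (psi : frob_lift) (f g : {mps Ku[n]}) : Prop :=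
  forall m : 'X_{1..n},
    has_sum (fun N (x : Ku) => exists w : W, x = (p%:R ^+ N * w)%:F)
      (fun l : 'X_{1..n} =>
         frobK (f l) * ((\prod_(j < n) psi (mpsX W j) ^+ l j : A) m)%:F)
      (g m).

End Crystals.

Arguments frob_lift {p} n {k} W.

(* Main.v *)
Require Import Defs.
From HB Require Import structures.
From mathcomp Require Import all_boot all_order all_algebra.
From mathcomp Require Import fraction mpoly boolp.
From mathcomp Require Import zify.
Set Implicit Arguments.
Unset Strict Implicit.
Unset Printing Implicit Defensive.
Import GRing.Theory.
Local Open Scope ring_scope.

(* Modulo p one has H_0 = Fil_(i-1) H_0 + Fil^i H_0, directly, for every i; by
   Nakayama and p-adic separatedness H = U_(i-1) + Fil^i H, directly, and the
   splitting H = sum_i (U_i cap Fil^i H) follows from the modular law.  The piece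
   of index i is isomorphic to U_i / U_(i-1) = V_i(-i), and a unit F-crystal over
   k[[t]], k algebraically closed, has a basis of horizontal Frobenius-fixed
   vectors: Lang's theorem gives it modulo (p, t), Artin-Schreier equations lift
   it over W, and the contraction X |-> B phi(X), phi : t |-> t^p, over W[[t]].
   Lifting these vectors to H gives a basis e on which nabla and F phi^* are
   block triangular with diagonal blocks 0 and p^i.

   For a W-linear form l on H / (t)H, the series l(D^m x)(0) t^m / m! defines an
   A-linear map from H to K^u[[t]] which commutes with the derivations.  Because
   H is divisible, the columns of F phi^* at t = 0 are divisible by p^i, and a
   p-adic contraction produces forms l_a, unipotent with respect to e, with
   l_a(F phi^* x) = p^i sigma(l_a(x)).  The rows of T are the resulting series of
   the vectors of e.  For another lift psi, the identity p^i psi(T) = T F(psi)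
   holds at t = 0 by the Taylor formula chi(psi, phi), and everywhere because both
   sides satisfy the same differential equation. *)

(** * Power series *)

Section PowerSeries.
Variables (n : nat) (R : comNzRingType).
Implicit Types (f g : {mps R[n]}) (m l : 'X_{1..n}).

Lemma mps_sumE (I : Type) (r : seq I) (P : pred I) (F : I -> {mps R[n]}) m :
  (\sum_(i <- r | P i) F i) m = \sum_(i <- r | P i) F i m.
Proof. exact: (big_morph (fun f : {mps R[n]} => f m)). Qed.

Lemma mpsM0E f g : (f * g) 0%MM = f 0%MM * g 0%MM.
Proof.
rewrite (mps_mul_trunc f g (leqnn (mdeg 0%MM).+1)) mcoeff0_is_multiplicative.
by rewrite !mps_truncE.
Qed.

Definition mps_cst f : R := f 0%MM.

Fact mps_cst_is_zmod_morphism : zmod_morphism mps_cst.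
Proof. by []. Qed.
Fact mps_cst_is_monoid_morphism : monoid_morphism mps_cst.
Proof. by split=> [|f g]; rewrite /mps_cst ?mps1E ?eqxx // mpsM0E. Qed.
HB.instance Definition _ :=
  GRing.isZmodMorphism.Build {mps R[n]} R mps_cst mps_cst_is_zmod_morphism.
HB.instance Definition _ :=
  GRing.isMonoidMorphism.Build {mps R[n]} R mps_cst mps_cst_is_monoid_morphism.

(** Transfers the laws of [mpoly] to series: a coefficient of a product depends only on the
    coefficients of the factors in degrees at most that of m. *)
Lemma mps_trunc_eqM f g m (p q : {mpoly R[n]}) :
    (forall l, (mdeg l < (mdeg m).+1)%N -> p@_l = f l) ->
    (forall l, (mdeg l < (mdeg m).+1)%N -> q@_l = g l) ->
  (p * q)@_m = (f * g) m.
Proof.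
move=> pf qg; rewrite (mps_mul_trunc _ _ (leqnn (mdeg m).+1)).
by apply: mpoly_mul_eqdeg (leqnn _) => l ld; rewrite mps_truncE ?pf ?qg.
Qed.

Lemma mpsCME a f m : (mpsC n a * f) m = a * f m.
Proof.
rewrite -[LHS](@mps_trunc_eqM _ _ _ a%:MP (mps_trunc (mdeg m).+1 f)).
- by rewrite mcoeffCM mps_truncE.
- by move=> l _; rewrite mcoeffC /= mulr_natr.
by move=> l ld; rewrite mps_truncE.
Qed.

Lemma mpsC0E (a : R) : mpsC n a 0%MM = a.
Proof. by rewrite /= eqxx. Qed.

Lemma mpsC_natX (q i : nat) : mpsC n (q%:R ^+ i) = q%:R ^+ i :> {mps R[n]}.
Proof.
apply/mpsP => m; rewrite -!natrX mpsMnE mps1E /=.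
by case: (m == 0%MM); rewrite ?mulr0n ?mul0rn.
Qed.

Lemma mps_natME (q : nat) f m : (q%:R * f) m = q%:R * f m.
Proof. by rewrite !mulr_natl mpsMnE. Qed.

Lemma mps_derivE i f m : mps_deriv i f m = f (m + U_(i))%MM *+ (m i).+1.
Proof. by []. Qed.

Fact mps_deriv_is_zmod_morphism i : zmod_morphism (@mps_deriv n R i).
Proof. by move=> f g; apply/mpsP=> m /=; rewrite mulrnBl. Qed.
HB.instance Definition _ i := GRing.isZmodMorphism.Build
  {mps R[n]} {mps R[n]} (@mps_deriv n R i) (mps_deriv_is_zmod_morphism i).

Lemma mps_derivM i f g :
  mps_deriv i (f * g) = mps_deriv i f * g + f * mps_deriv i g.
Proof.
apply/mpsP=> m; rewrite mpsDE mps_derivE.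
have dU : mdeg (m + U_(i)) = (mdeg m).+1 by rewrite mdegD mdeg1 addn1.
(* Degrees up to |m| + 1 are kept, because the coefficient of index m of a derivative comes from
   that degree. *)
set d := (mdeg m).+2.
have tE (h : {mps R[n]}) l : (mdeg l < (mdeg m).+1)%N ->
    (mderiv i (mps_trunc d h))@_l = mps_deriv i h l.
  move=> ld; rewrite mcoeff_deriv mps_truncE //.
  by rewrite mdegD mdeg1 addn1 ltnS.
have t'E (h : {mps R[n]}) l : (mdeg l < (mdeg m).+1)%N -> (mps_trunc d h)@_l = h l.
  by move=> ld; rewrite mps_truncE // (leq_trans ld).
rewrite -(mps_trunc_eqM (tE f) (t'E g)) -(mps_trunc_eqM (t'E f) (tE g)).
rewrite -mcoeffD -mderivM mcoeff_deriv; congr (_ *+ _).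
by rewrite (@mps_mul_trunc _ _ d) ?dU.
Qed.

Lemma mps_deriv1 i : mps_deriv i (1 : {mps R[n]}) = 0.
Proof.
by apply/mpsP=> m; rewrite mps_derivE mps1E mps0E mnmD_eq0 mnm1_eq0 andbF mul0rn.
Qed.

Lemma mps_derivX i f q :
  mps_deriv i (f ^+ q) = f ^+ q.-1 * mps_deriv i f *+ q.
Proof.
elim: q => [|q IH]; first by rewrite expr0 mps_deriv1 mulr0n.
rewrite exprS mps_derivM IH -pred_Sn mulrS mulrC; congr (_ + _).
case: q {IH} => [|q]; first by rewrite !mulr0n mulr0.
by rewrite -mulrnAr mulrA -exprS mulrnAr.
Qed.

Lemma mps_deriv_prod i (I : eqType) (r : seq I) (F : I -> {mps R[n]}) :
    uniq r ->
  mps_deriv i (\prod_(j <- r) F j) =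
  \sum_(j <- r) mps_deriv i (F j) * \prod_(l <- r | l != j) F l.
Proof.
elim: r => [|j r IH] /=; first by rewrite !big_nil mps_deriv1.
case/andP=> jr ur; rewrite !big_cons mps_derivM IH //= eqxx /=.
congr (_ * _ + _).
  rewrite big_seq [RHS]big_seq_cond; apply: eq_bigl => l /=.
  by rewrite andbC; case: (boolP (l \in r)) jr => [|//] lr; case: eqP lr => // ->->.
rewrite mulr_sumr [LHS]big_seq [RHS]big_seq; apply: eq_bigr => l lr.
have jl : j != l by apply: contraNneq jr => ->.
by rewrite big_cons jl; apply: mulrCA.
Qed.

(** Written with the exponents of the monomial of index e - U_(j), to match a shift of indices; when
    e j = 0 the truncated subtraction is harmless, since the term has multiplicity 0. *)
Lemma mps_deriv_prodX i (I : finType) (F : I -> {mps R[n]}) (e : I -> nat) :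
  mps_deriv i (\prod_j F j ^+ e j) =
  \sum_j (\prod_l F l ^+ (e l - (l == j))) * mps_deriv i (F j) *+ e j.
Proof.
rewrite mps_deriv_prod ?index_enum_uniq //; apply: eq_bigr => j _.
rewrite mps_derivX mulrnAl; congr (_ *+ _).
rewrite [in RHS](bigD1 j) //= eqxx subn1 mulrAC; congr (_ * _ * _).
by apply: eq_bigr => l /negPf ->; rewrite subn0.
Qed.

(** Congruence of families modulo the d-th power of the ideal (t_1, ..., t_n). *)
Definition mps_agree (T : Type) d (X Y : T -> {mps R[n]}) :=
  forall i m, (mdeg m < d)%N -> X i m = Y i m.

(** Contraction principle for the (t)-adic topology: the iterates of 0 have a coefficient of index m
    that is constant from stage |m| + 1 on. *)
Lemma mps_fixpoint (T : Type) (Phi : (T -> {mps R[n]}) -> T -> {mps R[n]}) :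
    (forall d X Y, mps_agree d X Y -> mps_agree d.+1 (Phi X) (Phi Y)) ->
  exists X, X = Phi X.
Proof.
move=> ctr; pose Xs s := iter s Phi (fun=> 0).
have Xs1 s : mps_agree s (Xs s) (Xs s.+1) by elim: s => [//|s IH]; exact: ctr.
have XsD s d : mps_agree s (Xs s) (Xs (s + d)%N).
  elim: d => [|d IH] i m md; first by rewrite addn0.
  by rewrite IH // addnS; apply: Xs1; apply: leq_trans md (leq_addr _ _).
pose X i := MPS (fun m => Xs (mdeg m).+1 i m).
have XE s : mps_agree s X (Xs s).
  move=> i m md; change (Xs (mdeg m).+1 i m = Xs s i m).
  by rewrite -(subnKC md); apply: XsD; exact: leqnn.
exists X; apply/funext=> i; apply/mpsP=> m.
rewrite (XE (mdeg m).+2) //.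
by apply/esym/(ctr _ _ _ (XE (mdeg m).+1)); apply: leqnSn.
Qed.

Lemma mpsM_agree d f1 f2 g1 g2 :
    (forall m, (mdeg m < d)%N -> f1 m = f2 m) ->
    (forall m, (mdeg m < d)%N -> g1 m = g2 m) ->
  forall m, (mdeg m < d)%N -> (f1 * g1) m = (f2 * g2) m.
Proof.
move=> ef eg m md; rewrite -(@mps_trunc_eqM f1 g1 m (mps_trunc d f2) (mps_trunc d g2)).
- by rewrite -mps_mul_trunc.
- by move=> l lm; have ld := leq_trans lm md; rewrite mps_truncE // ef.
- by move=> l lm; have ld := leq_trans lm md; rewrite mps_truncE // eg.
Qed.

(** A factor without constant term gains one degree: only coefficients of the other factor in
    degrees below |m| contribute. *)
Lemma mpsM_agree0 d f g1 g2 : f 0%MM = 0 ->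
    (forall m, (mdeg m < d)%N -> g1 m = g2 m) ->
  forall m, (mdeg m < d.+1)%N -> (f * g1) m = (f * g2) m.
Proof.
move=> f0 eg m md; rewrite !mpsME; apply: eq_bigr => l lm.
have [->|l0] := eqVneq (val l) 0%MM; first by rewrite f0 !mul0r.
congr (_ * _); apply: eg; rewrite -ltnS; apply: leq_trans md.
have := congr1 (@mdeg n) (submK lm); rewrite mdegD.
move: (l0 : bmnm l != 0%MM); move: (bmnm l) => l' {}l0 e.
by rewrite ltnS -e -{1}[mdeg (m - l')]addn0 ltn_add2l lt0n mdeg_eq0.
Qed.

End PowerSeries.

(** Geometric series: after division by the constant term, f is 1 - h with h without constant term,
    and the inverse is the fixed point of X = 1 + h X. *)
Lemma mps_unitP n (R : comUnitRingType) (f : {mps R[n]}) :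
  f 0%MM \is a GRing.unit -> f \is a GRing.unit.
Proof.
move=> u; pose a := mpsC n (f 0%MM)^-1.
pose h : {mps R[n]} := 1 - a * f.
have h0 : h 0%MM = 0 by rewrite mpsDE mpsNE mpsCME mulVr // mps1E eqxx subrr.
have [X XE] : exists X : unit -> {mps R[n]}, X = fun i => 1 + h * X i.
  apply: (mps_fixpoint (Phi := fun X i => 1 + h * X i)) => d X Y XY i m md.
  by rewrite !mpsDE; congr (_ + _); apply: mpsM_agree0 md => // l; apply: XY.
have Xh : (1 - h) * X tt = 1 by rewrite mulrBl mul1r {1}XE; exact: addrK.
apply/unitrPr; exists (a * X tt); rewrite mulrA [f * a]mulrC -Xh.
by rewrite /h opprB addrCA subrr addr0.
Qed.

Section SeriesMap.
Variables (n : nat) (R S : comNzRingType) (g : {rmorphism R -> S}).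
Local Notation map := (@mps_map n R S g).

Fact mps_map_is_zmod_morphism : zmod_morphism map.
Proof. by move=> f h; apply/mpsP=> m /=; rewrite rmorphB. Qed.
Fact mps_map_is_monoid_morphism : monoid_morphism map.
Proof.
split=> [|f h]; apply/mpsP=> m /=; first by rewrite rmorph_nat.
by rewrite rmorph_sum; apply: eq_bigr => l _; rewrite rmorphM.
Qed.
HB.instance Definition _ := GRing.isZmodMorphism.Build
  {mps R[n]} {mps S[n]} map mps_map_is_zmod_morphism.
HB.instance Definition _ := GRing.isMonoidMorphism.Build
  {mps R[n]} {mps S[n]} map mps_map_is_monoid_morphism.

Lemma mps_map_deriv i f : map (mps_deriv i f) = mps_deriv i (map f).
Proof. by apply/mpsP=> m /=; rewrite rmorphMn. Qed.

End SeriesMap.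

(** * Witt vectors and their fraction field *)

Section PowersDivide.
Variables (R : comNzRingType) (q : nat).
Implicit Types x y : R.

Definition pow_dvd N x := exists y, x = q%:R ^+ N * y.

Lemma pow_dvd0 N : pow_dvd N 0.
Proof. by exists 0; rewrite mulr0. Qed.
Lemma pow_dvdD N x y : pow_dvd N x -> pow_dvd N y -> pow_dvd N (x + y).
Proof. by move=> [x' ->] [y' ->]; exists (x' + y'); rewrite mulrDr. Qed.
Lemma pow_dvdN N x : pow_dvd N x -> pow_dvd N (- x).
Proof. by move=> [x' ->]; exists (- x'); rewrite mulrN. Qed.
Lemma pow_dvdM M N x y : pow_dvd M x -> pow_dvd N y -> pow_dvd (M + N) (x * y).
Proof. by move=> [x' ->] [y' ->]; exists (x' * y'); rewrite exprD mulrACA. Qed.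
Lemma pow_dvdMl N x y : pow_dvd N y -> pow_dvd N (x * y).
Proof. by move=> [y' ->]; exists (x * y'); rewrite mulrCA. Qed.
Lemma pow_dvd_refl N : pow_dvd N (q%:R ^+ N).
Proof. by exists 1; rewrite mulr1. Qed.
Lemma pow_dvd_le M N x : (M <= N)%N -> pow_dvd N x -> pow_dvd M x.
Proof.
by move=> MN [y ->]; exists (q%:R ^+ (N - M) * y); rewrite mulrA -exprD subnKC.
Qed.
Lemma pow_dvd_all x : pow_dvd 0 x.
Proof. by exists x; rewrite expr0 mul1r. Qed.
Lemma pow_dvd_sum (I : Type) (r : seq I) (P : pred I) (F : I -> R) N :
  (forall i, P i -> pow_dvd N (F i)) -> pow_dvd N (\sum_(i <- r | P i) F i).
Proof. by move=> h; apply: big_ind => //; [apply: pow_dvd0 | apply: pow_dvdD]. Qed.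
Lemma pow_dvd_prod (I : Type) (r : seq I) (P : pred I) (F : I -> R) (e : I -> nat) :
    (forall i, P i -> pow_dvd (e i) (F i)) ->
  pow_dvd (\sum_(i <- r | P i) e i) (\prod_(i <- r | P i) F i).
Proof.
by move=> h; apply: big_ind2 => //; [apply: pow_dvd_all | move=> *; apply: pow_dvdM].
Qed.

Lemma exact_quotK x y : (exists z, x = y * z) -> y * exact_quot x y = x.
Proof.
by move=> e; rewrite /exact_quot; case: pselect => // e'; case: (cid e').
Qed.

End PowersDivide.

Lemma rmorph_pow_dvd (R S : comNzRingType) (g : {rmorphism R -> S}) q N x :
  pow_dvd q N x -> pow_dvd q N (g x).
Proof. by move=> [y ->]; exists (g y); rewrite rmorphM rmorphXn rmorph_nat. Qed.

Section Witt.
Local Open Scope quotient_scope.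
Variables (p : nat) (k : closedFieldType).
Hypothesis hp : p \in [pchar k].
Variable W : witt_ring p k.
Local Notation dvd := (@pow_dvd W p).
Let p_pr : prime p := pcharf_prime hp.

Lemma witt_p_neq0 : (p%:R : W) != 0.
Proof.
apply/eqP=> p0; have := oner_neq0 W; rewrite (@witt_ptorsion_free _ _ W 1) ?eqxx //.
by rewrite p0 mul0r.
Qed.

Lemma witt_pX_neq0 s : (p%:R ^+ s : W) != 0.
Proof. by rewrite expf_neq0 ?witt_p_neq0. Qed.

Lemma pow_dvd_cancel M N w : dvd (M + N) (p%:R ^+ M * w) -> dvd N w.
Proof.
move=> [y]; rewrite exprD -mulrA => /(mulfI (witt_pX_neq0 M)) ->; by exists y.
Qed.

Lemma wres_dvd w : wres W w = 0 <-> dvd 1 w.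
Proof. by rewrite wres_ker; split=> -[v ->]; exists v. Qed.

(** Both w and 0 are sums of the zero expansion, so the uniqueness in [witt_complete] identifies
    them. *)
Lemma witt_separated w : (forall N, dvd N w) -> w = 0.
Proof.
move=> wN; have [s [_ uniq_s]] := witt_complete (fun=> (0 : W)).
have sum0 M : \sum_(i < M) (0 : W) * p%:R ^+ i = 0.
  by rewrite big1 // => i _; rewrite mul0r.
rewrite -(uniq_s w) => [|M]; last by rewrite sum0 subr0; apply: wN.
by apply: uniq_s => M; exists 0; rewrite sum0 subr0 mulr0.
Qed.

(** The successive differences are p^s u_s, and [witt_complete] sums the telescoping series. *)
Lemma witt_lim (T : Type) (X : nat -> T -> W) :
    (forall s i, dvd s (X s.+1 i - X s i)) ->
  exists Y : T -> W, forall s i, dvd s (Y i - X s i).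
Proof.
move=> hX; pose u i s := sval (cid (hX s i)).
have uE i s : X s.+1 i - X s i = p%:R ^+ s * u i s := svalP (cid (hX s i)).
have lim i : exists y, forall s, dvd s (y - X s i).
  have [y [yP _]] := witt_complete (u i); exists (y + X 0%N i) => s.
  have -> : X s i = X 0%N i + \sum_(j < s) u i j * p%:R ^+ j.
    elim: s => [|s IH]; first by rewrite big_ord0 addr0.
    by rewrite big_ord_recr /= addrA -IH mulrC -uE addrCA subrr addr0.
  by rewrite [X in _ - X]addrC opprD addrACA subrr addr0; apply: yP.
by exists (fun i => sval (cid (lim i))) => s i; apply: (svalP (cid (lim i))).
Qed.

(** Contraction principle for the p-adic topology, the counterpart of [mps_fixpoint]. *)
Lemma witt_fixpoint (T : Type) (Phi : (T -> W) -> T -> W) :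
    (forall d X Y, (forall i, dvd d (X i - Y i)) ->
                   forall i, dvd d.+1 (Phi X i - Phi Y i)) ->
  exists X, X = Phi X.
Proof.
move=> ctr; pose Xs s := iter s Phi (fun=> 0).
have XsP s : forall i, dvd s (Xs s.+1 i - Xs s i).
  by elim: s => [|s IH]; [move=> i; apply: pow_dvd_all | apply: ctr].
have [Y YP] := witt_lim XsP; exists Y; apply/funext => i.
apply/eqP; rewrite -subr_eq0; apply/eqP/witt_separated => N.
apply: (@pow_dvd_le _ _ _ N.+1) => //.
rewrite -[Y i - _](subrKA (Xs N.+1 i)); apply: pow_dvdD; first exact: YP.
by rewrite -opprB; apply: pow_dvdN; apply: ctr => j; apply: YP.
Qed.

(** Lifting the inverse of the residue gives w v = 1 - p y, which is inverted by a geometric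
    series. *)
Lemma witt_unitP w : wres W w != 0 -> w \is a GRing.unit.
Proof.
move=> w0; have [v vP] := wres_surj W (wres W w)^-1.
have : wres W (1 - w * v) = 0 by rewrite rmorphB rmorph1 rmorphM vP divff ?subrr.
case/wres_ker=> y yP.
have [X XE] : exists X : unit -> W, X = fun i => 1 + p%:R * y * X i.
  apply: (witt_fixpoint (Phi := fun X i => 1 + p%:R * y * X i)) => d X Y XY i.
  rewrite opprD addrACA subrr add0r -mulrBr -add1n; apply: pow_dvdM => //.
  by exists y.
apply/unitrPr; exists (v * X tt); rewrite mulrA.
have -> : w * v = 1 - p%:R * y by rewrite -yP opprB addrCA subrr addr0.
by rewrite mulrBl mul1r {1}XE addrK.
Qed.

(** By separatedness some p^N does not divide w; induction on N strips factors p until the residue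
    is nonzero. *)
Lemma witt_valuation w : w != 0 ->
  exists s, exists2 u : W, u \is a GRing.unit & w = p%:R ^+ s * u.
Proof.
move=> w0.
have [N nN] : exists N, ~ dvd N w.
  by apply/existsNP => h; move: w0; rewrite (witt_separated h) eqxx.
elim: N w w0 nN => [|N IH] w w0 nN; first by case: nN; apply: pow_dvd_all.
have [/wres_ker[v vE]|/witt_unitP uw] := eqVneq (wres W w) 0; last first.
  by exists 0%N, w; rewrite // expr0 mul1r.
have [||s [u uu vu]] := IH v.
- by apply: contraNneq w0 => v0; rewrite vE v0 mulr0.
- by move=> [y yE]; apply: nN; exists y; rewrite vE yE exprS mulrA.
by exists s.+1, u; rewrite // vE vu exprS mulrA.
Qed.

Lemma witt_nat_unit q : coprime p q -> (q%:R : W) \is a GRing.unit.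
Proof.
move=> cpq; apply: witt_unitP; rewrite rmorph_nat.
by rewrite -(dvdn_pcharf hp) -prime_coprime.
Qed.

Lemma witt_nat_val q : (0 < q)%N ->
  exists2 u : W, u \is a GRing.unit & q%:R = p%:R ^+ logn p q * u.
Proof.
move=> q0; have [u cu qE] := pfactor_coprime p_pr q0.
by exists u%:R; rewrite ?witt_nat_unit // {1}qE natrM natrX mulrC.
Qed.

Lemma witt_nat_neq0 q : (0 < q)%N -> (q%:R : W) != 0.
Proof.
move=> q0; have [u uu ->] := witt_nat_val q0.
by rewrite mulf_neq0 ?witt_pX_neq0 //; apply: contraTneq uu => ->; rewrite unitr0.
Qed.

(** Legendre's formula. The sum of the floors of q / p^i telescopes against p - 1, leaving the last
    floor as a remainder; stopping at the largest power of p below q keeps it positive, hence the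
    strict inequality. *)
Lemma logn_fact_bound q : (0 < q)%N -> (p.-1 * logn p q`! < q)%N.
Proof.
move=> q0; have p1 := prime_gt1 p_pr.
have bnd K : (p.-1 * (\sum_(1 <= i < K.+1) q %/ p ^ i) + q %/ p ^ K <= q)%N.
  elim: K => [|K IH]; first by rewrite big_geq // muln0 expn0 divn1.
  apply: leq_trans IH; rewrite big_nat_recr //= mulnDr -addnA leq_add2l.
  rewrite -{2}[(q %/ p ^ K.+1)%N]mul1n -mulnDl addn1 prednK ?prime_gt0 //.
  by rewrite expnSr divnMA mulnC leq_divM.
have lq : (trunc_log p q <= q)%N.
  by apply: leq_trans (ltnW (ltn_expl _ p1)) (trunc_logP p1 q0).
rewrite logn_fact // (big_cat_nat (n := (trunc_log p q).+1)) //=.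
rewrite [X in (_ + X)%N]big_nat_cond [X in (_ + X)%N]big1 => [|i]; last first.
  rewrite andbT => /andP[qi _]; apply: divn_small.
  exact: leq_trans (trunc_log_ltn q p1) (leq_pexp2l (ltnW p1) qi).
rewrite addn0; have := bnd (trunc_log p q).
have: (0 < q %/ p ^ trunc_log p q)%N.
  by rewrite divn_gt0 ?expn_gt0 ?prime_gt0 // trunc_logP.
move: (q %/ p ^ _)%N (p.-1 * _)%N => a b; lia.
Qed.

(** Let v be the valuation of m!. Either v = 0, or (p - 1) v < m gives m - v > (p - 2) v >= p - 2,
    so that m - v >= p - 1. *)
Lemma exact_quot_fact_dvd m :
  dvd (minn m p.-1) (exact_quot (p%:R ^+ m) (m`!)%:R) /\
  (m`!)%:R * exact_quot (p%:R ^+ m) (m`!)%:R = p%:R ^+ m :> W.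
Proof.
have p1 := prime_gt1 p_pr.
have [u uu fE] := witt_nat_val (fact_gt0 m).
have vm : (logn p m`! + minn m p.-1 <= m)%N.
  have [->|m0] := posnP m; first by rewrite fact0 logn1 min0n.
  have := logn_fact_bound m0; case: (logn p m`!) => [|v]; first by rewrite add0n geq_minl.
  case: (p) p1 => [|[|p']] // _ /=; have : (p' <= p' * v.+1)%N by rewrite leq_pmulr.
  by rewrite mulSn; lia.
have fe : (m`!)%:R * exact_quot (p%:R ^+ m) (m`!)%:R = p%:R ^+ m :> W.
  apply: exact_quotK; exists (u^-1 * p%:R ^+ (m - logn p m`!)).
  rewrite fE mulrA mulrK // -exprD subnKC //.
  exact: leq_trans (leq_addr _ _) vm.
split=> //; move: fe; set e := exact_quot _ _ => fe.
rewrite -[e](mulKr uu); apply: pow_dvdMl; apply: (@pow_dvd_cancel (logn p m`!)).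
by rewrite mulrA -fE fe; apply: pow_dvd_le vm (pow_dvd_refl _ _ _).
Qed.

Local Notation Ku := {fraction W}.

Lemma fractionE (x : Ku) : x = (\n_(repr x))%:F / (\d_(repr x))%:F.
Proof.
have dF : (\d_(repr x))%:F != 0 :> Ku by rewrite tofrac_eq0 denom_ratioP.
apply: (mulIf dF); rewrite divfK // {dF}.
have := reprK x; move: (repr x) => r rx; rewrite -{}rx {x}; unlock FracField.tofrac.
rewrite -[LHS]FracField.pi_mul; apply/eqmodP.
rewrite /= FracField.equivfE /FracField.mulf.
rewrite !numden_Ratio ?mulf_neq0 ?oner_neq0 ?denom_ratioP //.
by rewrite !mulr1 mulrC.
Qed.

(** The unit part of the denominator is absorbed into the numerator. *)
Lemma frac_wittP (x : Ku) : exists (w : W) s, x = w%:F / p%:R ^+ s.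
Proof.
have [s [u uu dE]] := witt_valuation (denom_ratioP (repr x)).
exists (\n_(repr x) / u), s; rewrite {1}[x]fractionE {}dE rmorphM rmorphXn rmorph_nat /=.
have uF : u%:F != 0 :> Ku.
  by rewrite tofrac_eq0; apply: contraTneq uu => ->; rewrite unitr0.
rewrite invfM mulrA mulrAC; congr (_ / _).
by apply: (mulIf uF); rewrite divfK // -rmorphM divrK.
Qed.

(** [frobK] is computed on the representative chosen by [repr]; this frees it from that choice,
    using that sigma is injective. *)
Lemma frobK_div (a b : W) : b != 0 ->
  frobK (a%:F / b%:F : Ku) = (wfrob W a)%:F / (wfrob W b)%:F.
Proof.
have finj := bij_inj (wfrob_bij W).
have F0 c : c != 0 -> (wfrob W c)%:F != 0 :> Ku.
  by move=> c0; rewrite tofrac_eq0 -(rmorph0 (wfrob W)) (inj_eq finj).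
move=> b0; rewrite /frobK; set x := a%:F / _.
have d0 := denom_ratioP (repr x).
apply/eqP; rewrite eqr_div ?F0 // -!rmorphM; apply/eqP; congr (_ %:F); congr (wfrob W _).
apply/eqP; rewrite -tofrac_eq !rmorphM /= -eqr_div ?tofrac_eq0 // -fractionE eqxx //.
Qed.

Lemma frobK_tofrac (a : W) : frobK (a%:F : Ku) = (wfrob W a)%:F.
Proof. by have := frobK_div a (oner_neq0 W); rewrite !rmorph1 !divr1. Qed.

Lemma frobKM (x y : Ku) : frobK (x * y) = frobK x * frobK y.
Proof.
have F0 (z : W) : z != 0 -> (wfrob W z)%:F != 0 :> Ku.
  by move=> c0; rewrite tofrac_eq0 -(rmorph0 (wfrob W)) (inj_eq (bij_inj (wfrob_bij W))).
rewrite [x]fractionE [y]fractionE mulf_div -!rmorphM.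
by rewrite !frobK_div ?mulf_neq0 ?denom_ratioP // !rmorphM -mulf_div.
Qed.

Lemma frobK_nat q : frobK (q%:R : Ku) = q%:R.
Proof.
rewrite -[q%:R in LHS](rmorph_nat (@FracField.tofrac W)).
by rewrite frobK_tofrac !rmorph_nat.
Qed.

Lemma frac_nat_neq0 q : (0 < q)%N -> (q%:R : Ku) != 0.
Proof.
by move=> q0; rewrite -(rmorph_nat (@FracField.tofrac W)) tofrac_eq0 witt_nat_neq0.
Qed.

End Witt.

(** * The lift of Frobenius t |-> t^p *)

Section FrobeniusSubstitution.
Variables (n p : nat) (R S : comNzRingType) (g : {rmorphism R -> S}).
Hypothesis p_gt0 : (0 < p)%N.
Implicit Types (m l : 'X_{1..n}).

Definition mnm_dvd m := [forall i, p %| m i]%N.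
Definition mnm_quo m : 'X_{1..n} := [multinom (m i %/ p)%N | i < n].

(* f(t) |-> (g f)(t_1 ^ p, ..., t_n ^ p) *)
Definition mps_frob (f : {mps R[n]}) : {mps S[n]} :=
  MPS (fun m => if mnm_dvd m then g (f (mnm_quo m)) else 0).

Lemma mps_frobE f m :
  mps_frob f m = if mnm_dvd m then g (f (mnm_quo m)) else 0.
Proof. by []. Qed.

(** The same substitution on polynomials: as an [mmap] it is multiplicative, and truncation
    transfers this to [mps_frob]. *)
Definition mpoly_frob (P : {mpoly R[n]}) : {mpoly S[n]} :=
  mmap (@mpolyC n S \o g) (fun i => 'X_i ^+ p) P.

Lemma eq_mnm_muln l m : ((l *+ p)%MM == m) = mnm_dvd m && (l == mnm_quo m).
Proof.
apply/eqP/andP => [<-|[/forallP pm /eqP->]].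
  split; first by apply/forallP => i; rewrite mulmnE dvdn_mull.
  by apply/eqP/mnmP => i; rewrite mnmE mulmnE mulnK.
by apply/mnmP => i; rewrite mulmnE mnmE divnK.
Qed.

Lemma mcoeff_mpoly_frob P m :
  (mpoly_frob P)@_m = if mnm_dvd m then g P@_(mnm_quo m) else 0.
Proof.
rewrite /mpoly_frob /mmap raddf_sum /=.
transitivity (\sum_(l <- msupp P) if mnm_dvd m && (l == mnm_quo m) then g P@_l else 0).
  apply: eq_bigr => l _; rewrite mcoeffCM /mmap1.
  under eq_bigr do rewrite -exprM mulnC exprM.
  rewrite prodrXl -mpolyXE_id mcoeffXn eq_mnm_muln.
  by case: ifP; rewrite ?mulr1 ?mulr0.
case: ifP => pm /=; last by rewrite big1.
have [ml|ml] := boolP (mnm_quo m \in msupp P).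
  rewrite (bigD1_seq (mnm_quo m)) ?msupp_uniq //= eqxx big1 ?addr0 // => l.
  by move/negPf->.
rewrite (memN_msupp_eq0 ml) rmorph0 big1_seq // => l /andP[_ lP].
by case: eqP => // lm; rewrite -lm lP in ml.
Qed.

Lemma mdeg_mnm_quo m d : (mdeg m < d)%N -> (mdeg (mnm_quo m) < d)%N.
Proof.
apply: leq_ltn_trans; rewrite !mdegE; apply: leq_sum => i _.
by rewrite mnmE leq_div.
Qed.

Lemma mps_frob_trunc d f m : (mdeg m < d)%N ->
  (mpoly_frob (mps_trunc d f))@_m = mps_frob f m.
Proof. by move=> md; rewrite mcoeff_mpoly_frob /= mps_truncE ?mdeg_mnm_quo. Qed.

Fact mps_frob_is_zmod_morphism : zmod_morphism mps_frob.
Proof.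
by move=> f h; apply/mpsP => m /=; case: ifP; rewrite ?subr0 // rmorphB.
Qed.
Fact mps_frob_is_monoid_morphism : monoid_morphism mps_frob.
Proof.
split=> [|f h]; apply/mpsP => m.
  have := eq_mnm_muln 0%MM m; have -> : (0 *+ p)%MM = 0%MM :> 'X_{1..n}.
    by apply/mnmP => i; rewrite mulmnE mnm0E.
  move=> e; rewrite mps_frobE !mps1E [m == _]eq_sym e [mnm_quo m == _]eq_sym.
  by case: ifP => //= _; rewrite rmorph_nat.
have mm := leqnn (mdeg m).+1.
rewrite -(mps_frob_trunc _ mm) mcoeff_mpoly_frob mps_trunc_mul ?mdeg_mnm_quo //.
rewrite -mcoeff_mpoly_frob.
rewrite [mpoly_frob _]rmorphM.
by apply: mps_trunc_eqM => l lm; apply: mps_frob_trunc.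
Qed.

HB.instance Definition _ := GRing.isZmodMorphism.Build
  {mps R[n]} {mps S[n]} mps_frob mps_frob_is_zmod_morphism.
HB.instance Definition _ := GRing.isMonoidMorphism.Build
  {mps R[n]} {mps S[n]} mps_frob mps_frob_is_monoid_morphism.

Lemma mps_frob0E f : mps_frob f 0%MM = g (f 0%MM).
Proof.
have -> : 0%MM = (0 *+ p)%MM :> 'X_{1..n} by apply/mnmP => i; rewrite mulmnE mnm0E.
have /andP[d /eqP q] : mnm_dvd (0 *+ p) && (0%MM == mnm_quo (0 *+ p)).
  by rewrite -eq_mnm_muln eqxx.
by rewrite /= d -q; congr (g (f _)); apply/mnmP => i; rewrite mulmnE mnm0E.
Qed.

(** The substitution multiplies degrees by p > 1, so a nonconstant coefficient comes from a strictly
    lower degree. Equality of the constant terms is a separate assumption for the sake of d = 0. *)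
Lemma mps_frob_agree d (f h : {mps R[n]}) : (1 < p)%N -> f 0%MM = h 0%MM ->
    (forall m, (mdeg m < d)%N -> f m = h m) ->
  forall m, (mdeg m < d.+1)%N -> mps_frob f m = mps_frob h m.
Proof.
move=> p1 fh0 fh m md /=; case: ifP => // /forallP pm; congr (g _).
have [->//|q0] := eqVneq (mnm_quo m) 0%MM.
apply: fh; rewrite -ltnS; apply: leq_trans md; rewrite ltnS.
have -> : m = (mnm_quo m *+ p)%MM.
  by apply/mnmP => i; rewrite mulmnE mnmE divnK.
have -> : mnm_quo (mnm_quo m *+ p) = mnm_quo m.
  by apply/mnmP => i; rewrite !mnmE mulmnE mnmE mulnK.
by rewrite mdegMn -[X in (X < _)%N]muln1 ltn_pmul2l // lt0n mdeg_eq0.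
Qed.

End FrobeniusSubstitution.

(** On truncations, which are polynomials in characteristic p, the p-th power is additive and can be
    computed monomial by monomial. *)
Lemma mps_frob_pchar n p (F : fieldType) (hp : p \in [pchar F]) (f : {mps F[n]}) :
  mps_frob p (pFrobenius_aut hp) f = f ^+ p.
Proof.
apply/mpsP => m; have p_pr := pcharf_prime hp; have p0 := prime_gt0 p_pr.
have powE d q l : (mdeg l < d)%N -> (f ^+ q) l = (mps_trunc d f ^+ q)@_l.
  elim: q l => [|q IH] l ld; first by rewrite !expr0 mcoeff1.
  rewrite !exprS -(@mps_trunc_eqM _ _ _ _ _ (mps_trunc d f) (mps_trunc d f ^+ q)) //.
    by move=> l' l'd; rewrite mps_truncE // (leq_trans l'd).
  by move=> l' l'd; rewrite IH // (leq_trans l'd).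
rewrite (powE _ _ _ (leqnn _)) {powE}.
have hpP : p \in [pchar {mpoly F[n]}].
  by rewrite inE p_pr /= -mpolyC_nat (pcharf0 hp).
set P := mps_trunc _ f.
have -> : P ^+ p = mmap (@mpolyC n F \o pFrobenius_aut hp) (fun i => 'X_i ^+ p) P.
  rewrite {1}[P]mpolyE -(pFrobenius_autE hpP) rmorph_sum /mmap; apply: eq_bigr => l _.
  rewrite /= !pFrobenius_autE /mmap1.
  under [in RHS]eq_bigr do rewrite -exprM mulnC exprM.
  by rewrite prodrXl -mpolyXE_id exprZn mul_mpolyC.
by rewrite -(mps_frob_trunc _ p0 f (leqnn _)).
Qed.

Section StandardLift.
Variables (p n : nat) (k : closedFieldType).
Hypothesis hp : p \in [pchar k].
Variable W : witt_ring p k.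
Let p_pr : prime p := pcharf_prime hp.
Local Notation A := {mps W[n]}.

Definition std_mor : A -> A := mps_frob p (wfrob W).
HB.instance Definition _ := GRing.isZmodMorphism.Build A A std_mor
  (@mps_frob_is_zmod_morphism n p _ _ (wfrob W)).
HB.instance Definition _ := GRing.isMonoidMorphism.Build A A std_mor
  (mps_frob_is_monoid_morphism n (wfrob W) (prime_gt0 p_pr)).

Fact std_mor_const w : std_mor (mpsC n w) = mpsC n (wfrob W w).
Proof.
apply/mpsP => m; have := eq_mnm_muln (prime_gt0 p_pr) 0%MM m.
have -> : (0 *+ p)%MM = 0%MM :> 'X_{1..n}.
  by apply/mnmP => i; rewrite mulmnE mnm0E.
rewrite [std_mor _ _]mps_frobE => e /=; rewrite [m == _]eq_sym e [mnm_quo _ m == _]eq_sym.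
by case: ifP => //= _; rewrite rmorphMn.
Qed.

Fact std_mor_modp f : redA (std_mor f) = redA f ^+ p.
Proof.
rewrite -(mps_frob_pchar hp); apply/mpsP => m; rewrite mps_frobE /=.
by case: ifP; rewrite ?rmorph0 // wfrob_lift pFrobenius_autE.
Qed.

Definition std_lift : frob_lift n W := FrobLift std_mor_const std_mor_modp.

Lemma std_lift_cst f : std_lift f 0%MM = wfrob W (f 0%MM).
Proof. exact: mps_frob0E (prime_gt0 p_pr) _. Qed.

Lemma std_lift_agree d (f h : A) : f 0%MM = h 0%MM ->
    (forall m, (mdeg m < d)%N -> f m = h m) ->
  forall m, (mdeg m < d.+1)%N -> std_lift f m = std_lift h m.
Proof. exact: mps_frob_agree (prime_gt0 p_pr) _ _ _ (prime_gt1 p_pr). Qed.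

End StandardLift.

(** * Lang's theorem for GL_r *)

Section Lang.
Variables (k : closedFieldType) (p : nat).
Hypothesis hp : p \in [pchar k].
Let p_pr : prime p := pcharf_prime hp.
Let p_gt0 : (0 < p)%N := prime_gt0 p_pr.
Let p_gt1 : (1 < p)%N := prime_gt1 p_pr.
Let p1F : (p.-1 == 0)%N = false.
Proof. by apply: gtn_eqF; rewrite -ltnS prednK. Qed.
Local Notation Frob := (pFrobenius_aut hp).

Lemma artin_schreier (c : k) : exists z, z ^+ p - z = c.
Proof.
pose P : {poly k} := 'X^p - 'X - c%:P.
have sP : size P != 1%N.
  rewrite /P -addrA size_polyDl ?size_polyXn; first by rewrite eqSS -lt0n.
  rewrite -opprD size_polyN; apply: leq_ltn_trans (size_polyD _ _) _.
  rewrite size_polyX gtn_max ltnS p_gt1 size_polyC.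
  by case: (c != 0); rewrite ?ltnS ?p_gt0.
have [z /rootP] := closed_rootP _ sP.
by rewrite !hornerE => /eqP; rewrite subr_eq0 => /eqP; exists z.
Qed.

Definition frob_semi r (B : 'M[k]_r) (x : 'cV[k]_r) : 'cV[k]_r := B *m map_mx Frob x.

Section FixedVector.
Variables (r : nat) (B : 'M[k]_r).
Hypothesis uB : B \in unitmx.
Local Notation F := (frob_semi B).

Lemma frob_semiD x y : F (x + y) = F x + F y.
Proof. by rewrite /frob_semi map_mxD mulmxDr. Qed.
Lemma frob_semiZ a x : F (a *: x) = a ^+ p *: F x.
Proof. by rewrite /frob_semi map_mxZ -scalemxAr /= pFrobenius_autE. Qed.
Lemma frob_semi0 : F 0 = 0.
Proof. by rewrite /frob_semi map_mx0 mulmx0. Qed.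
Lemma frob_semi_sum (I : Type) (s : seq I) (P : pred I) (G : I -> 'cV[k]_r) :
  F (\sum_(i <- s | P i) G i) = \sum_(i <- s | P i) F (G i).
Proof. exact: (big_morph F frob_semiD frob_semi0). Qed.
Lemma frob_semi_eq0 x : F x = 0 -> x = 0.
Proof.
move=> /(congr1 (mulmx (invmx B))); rewrite mulmx0 mulKmx // => /eqP.
by rewrite map_mx_eq0 => /eqP.
Qed.

(** A fixed vector is sought in the span of the orbit of x, up to the first linear dependency. Its
    coefficients are determined by the last one, which is a root of a one-variable polynomial.
    Minimality of the dependency makes the vector nonzero. *)
Lemma frob_semi_fixed (x : 'cV[k]_r) : x != 0 ->
  exists2 y, y != 0 & F y = y.
Proof.
move=> x0.
pose dep d := `[< exists a : nat -> k, iter d F x = \sum_(i < d) a i *: iter i F x >].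
(* Among r + 1 vectors in dimension r there is a relation; its last term with a nonzero coefficient
   is a combination of the preceding ones. *)
have ex_dep : exists d, dep d.
  pose X := \matrix_(i < r.+1) (iter i F x)^T.
  have : ~~ row_free X by rewrite -row_leq_rank -ltnNge ltnS rank_leq_col.
  rewrite -kermx_eq0 => /rowV0Pn[v /sub_kermxP vX v0].
  have [i vi] : exists i, v 0 i != 0 by apply/rV0Pn.
  have [j vj jmax] := @arg_maxnP 'I_r.+1 i (fun i => v 0 i != 0) (@nat_of_ord r.+1) vi.
  exists (val j); apply/asboolP.
  pose w i := v 0 (inord i); exists (fun i => - ((w j)^-1 * w i)).
  have wj : w j != 0 by rewrite /w inord_val.
  have : \sum_(0 <= i < r.+1) w i *: iter i F x = 0.
    rewrite big_mkord -[RHS]trmx0 -[in RHS]vX mulmx_sum_row linear_sum /=.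
    by apply: eq_bigr => l _; rewrite linearZ /= rowK trmxK /w inord_val.
  rewrite (big_cat_nat (n := j.+1)) //= [X in _ + X]big1_seq ?addr0 => [|l]; last first.
    rewrite mem_index_iota => /andP[_ /andP[jl lr]]; have [->|wl] := eqVneq (w l) 0.
      by rewrite scale0r.
    have : ((inord l : 'I_r.+1) <= j)%N := jmax (inord l) wl.
    by rewrite inordK // leqNgt jl.
  rewrite big_nat_recr //= big_mkord addrC => /eqP; rewrite addr_eq0 => /eqP e.
  rewrite -[LHS](scalerK wj) e scalerN scaler_sumr -sumrN.
  by apply: eq_bigr => l _; rewrite scalerA scaleNr.
have [d /asboolP[a aE] dmin] := ex_minnP ex_dep.
have iter0 i : iter i F x != 0.
  by elim: i => //= i; apply: contraNneq => /frob_semi_eq0 ->.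
case: d a aE dmin => [|d] a aE dmin.
  by move: (iter0 0%N); rewrite aE big_ord0 eqxx.
(* sum_i c_i F^i x is fixed iff c_0 = a_0 z^p, c_(i+1) = c_i^p + a_(i+1) z^p and
   z = c_d; here c_i = z^p S_i(z), and the last equation is polynomial in z. *)
pose S := fix S j : {poly k} := if j is j'.+1 then
  'X^(p * p.-1) * S j' ^+ p + (a j)%:P else (a 0%N)%:P.
(* Evaluation at 0 gives a_j = 0. So S_d = 0 would make F^(d+1) x vanish, against the injectivity of
   F. *)
have S0 j : S j = 0 -> forall i, (i <= j)%N -> a i = 0.
  elim: j => [|j IH] /=.
    by move=> /eqP; rewrite polyC_eq0 => /eqP a0 i; rewrite leqn0 => /eqP->.
  move=> e; have aj : a j.+1 = 0.
    have /eqP := congr1 (fun P => P.[0]) e.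
    by rewrite !hornerE expr0n muln_eq0 gtn_eqF // p1F mul0r add0r => /eqP.
  move: e; rewrite aj addr0 => /eqP; rewrite mulf_eq0 expf_eq0 polyX_eq0 andbF /=.
  rewrite expf_eq0 p_gt0 /= => /eqP/IH a0 i.
  by rewrite leq_eqVlt => /predU1P[->//|]; apply: a0.
(* This is c_d = z with a factor z cancelled, which forces the root to be nonzero. *)
have [z zE] : exists z, z ^+ p.-1 * (S d).[z] = 1.
  have Sd : S d != 0.
    apply/eqP => /S0 a0; move: (iter0 d.+1); rewrite aE big1 ?eqxx // => i _.
    by rewrite a0 ?scale0r // -ltnS.
  have : size ('X^(p.-1) * S d - 1) != 1%N.
    have sz : (1 < size ('X^(p.-1) * S d)%R)%N.
      rewrite size_monicM ?monicXn // size_polyXn addSn /=.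
      have := size_poly_gt0 (S d); rewrite Sd => s0.
      by rewrite -(prednK s0) addnS ltnS addn_gt0 lt0n p1F.
    rewrite size_polyDl; first by rewrite gtn_eqF.
    by rewrite size_polyN size_poly1.
  move=> /closed_rootP[z /rootP]; rewrite !hornerE => /eqP.
  by rewrite subr_eq0 => /eqP; exists z.
have z0 : z != 0.
  apply: contra_eq_neq zE => ->.
  by rewrite expr0n p1F mul0r eq_sym oner_neq0.
pose c j := z ^+ p * (S j).[z].
have cd : c d = z by rewrite /c -(prednK p_gt0) exprS -mulrA zE mulr1.
have c0 : c 0%N = a 0%N * z ^+ p by rewrite /c hornerC mulrC.
have cS j : c j.+1 = c j ^+ p + a j.+1 * z ^+ p.
  rewrite /c /= !hornerE exprMn -!exprM mulrDr mulrA -exprD -mulnS prednK //.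
  by rewrite [z ^+ p * a _]mulrC.
clearbody c; exists (\sum_(i < d.+1) c i *: iter i F x).
  apply/eqP; rewrite big_ord_recr /= cd addrC => /eqP; rewrite addr_eq0 => /eqP e.
  suff /dmin : dep d by rewrite ltnn.
  apply/asboolP; exists (fun i => - (z^-1 * c i)).
  rewrite -[LHS](scalerK z0) e scalerN scaler_sumr -sumrN.
  by apply: eq_bigr => l _; rewrite scalerA scaleNr.
rewrite frob_semi_sum; under eq_bigr do rewrite frob_semiZ -iterS.
rewrite big_ord_recr /= -iterS cd aE scaler_sumr big_ord_recl [RHS]big_ord_recl.
rewrite addrCA c0 scalerA mulrC; congr (_ + _); rewrite -big_split /=.
by apply: eq_bigr => i _; rewrite scalerA -scalerDl cS mulrC.
Qed.

End FixedVector.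
(** In the rank decomposition of the row y^T the left factor is a scalar a, so y^T is the first row
    of a times the right factor. *)
Lemma first_col_unitmx r (y : 'cV[k]_(1 + r)) : y != 0 ->
  exists2 g : 'M[k]_(1 + r), g \in unitmx & lsubmx g = y.
Proof.
move=> y0; have rk : \rank y^T = 1%N by rewrite rank_rV trmx_eq0 y0.
pose a := col_ebase y^T 0 0; pose E := row_ebase y^T.
have aE : col_ebase y^T = a%:M by apply: mx11_scalar.
have a0 : a != 0.
  have := col_ebase_unit y^T; rewrite aE unitmxE det_scalar expr1.
  by rewrite unitfE.
exists (a *: E)^T.
  by rewrite unitmx_tr unitmxZ ?unitfE // row_ebase_unit.
have := mulmx_ebase y^T; rewrite aE rk mul_scalar_mx -scalemxAl => /(congr1 trmx).
rewrite trmxK => <-; rewrite -/E -trmx_usub linearZ /=; congr (_ *: _)^T.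
rewrite -[E in RHS]vsubmxK.
have -> : pid_mx 1 = row_mx 1%:M 0 :> 'M[k]_(1, 1 + r).
  by apply/matrixP => i j; rewrite !mxE; case: splitP => l ->; rewrite !mxE ?ord1.
by rewrite mul_row_col mul1mx mul0mx addr0.
Qed.

(** Induction on r. In a basis starting with a fixed vector, B becomes block triangular with first
    column (1, 0). The induction hypothesis treats the lower block, and each entry of the row s
    above it solves an Artin-Schreier equation. *)
Lemma lang r (B : 'M[k]_r) : B \in unitmx ->
  exists2 G : 'M[k]_r, G \in unitmx & B *m map_mx Frob G = G.
Proof.
elim: r B => [|r IH] B uB.
  by exists 1%:M; [apply: unitmx1 | rewrite [LHS]flatmx0 [RHS]flatmx0].
have e0 : (delta_mx 0 0 : 'cV[k]_(1 + r)) != 0.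
  by apply/eqP => /matrixP/(_ 0 0)/eqP; rewrite !mxE !eqxx oner_eq0.
have [y y0 yF] := frob_semi_fixed uB e0.
have [g ug gy] := first_col_unitmx y0.
pose B' : 'M[k]_(1 + r) := invmx g *m B *m map_mx Frob g.
have uB' : B' \in unitmx.
  by rewrite !unitmx_mul unitmx_inv ug (uB : B \in unitmx) map_unitmx.
have lB' : lsubmx B' = col_mx 1%:M 0.
  have lM (M1 M2 : 'M[k]_(1 + r)) : lsubmx (M1 *m M2) = M1 *m lsubmx M2.
    by rewrite -{1}[M2]hsubmxK mul_mx_row row_mxKl.
  rewrite lM -map_lsubmx gy -mulmxA [B *m _]yF -gy -lM mulVmx //.
  by rewrite scalar_mx_block block_mxEh row_mxKl.
have B'E : B' = block_mx 1%:M (ursubmx B') 0 (drsubmx B').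
  rewrite block_mxEh -[LHS]hsubmxK lB' -[rsubmx B']vsubmxK.
  by congr (row_mx _ (col_mx _ _)); apply/matrixP => i j; rewrite !mxE.
have uB'' : drsubmx B' \in unitmx.
  by move: uB'; rewrite !unitmxE {1}B'E det_ublock det1 mul1r.
have [G'' uG'' FG''] := IH _ uB''.
have [s sE] : exists s : 'rV[k]_r, map_mx Frob s + ursubmx B' *m map_mx Frob G'' = s.
  pose c := ursubmx B' *m map_mx Frob G''.
  exists (\row_j sval (cid (artin_schreier (- c 0 j)))); apply/rowP => j.
  rewrite mxE -/c; set s := \row_j _.
  have := svalP (cid (artin_schreier (- c 0 j))).
  rewrite [s 0 j]mxE [map_mx _ _ _ _]mxE [s 0 j]mxE pFrobenius_autE.
  by move/eqP; rewrite subr_eq => /eqP->; rewrite addrAC addNr add0r.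
pose G' : 'M[k]_(1 + r) := block_mx 1%:M s 0 G''.
have FG' : B' *m map_mx Frob G' = G'.
  rewrite {1}B'E map_block_mx map_mx1 map_mx0 mulmx_block.
  by rewrite !mul0mx !mulmx0 !mul1mx !addr0 add0r sE FG''.
have uG' : G' \in unitmx by rewrite unitmxE det_ublock det1 mul1r -unitmxE.
exists (g *m G'); first by rewrite unitmx_mul ug.
by rewrite map_mxM /= -{2}FG' /B' !mulmxA mulmxV // mul1mx.
Qed.

(** With B F(G) = G, the substitution D = G Z turns the system into independent scalar
    Artin-Schreier equations for the entries of Z. *)
Lemma lang_artin_schreier r s (B : 'M[k]_r) (E : 'M[k]_(r, s)) : B \in unitmx ->
  exists D : 'M[k]_(r, s), B *m map_mx Frob D - D = E.
Proof.
move=> uB; have [G uG GE] := lang uB.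
pose Z := \matrix_(i < r, j < s) sval (cid (artin_schreier ((invmx G *m E) i j))).
exists (G *m Z); rewrite map_mxM mulmxA GE -mulmxBr.
rewrite -[RHS](mulKVmx uG); congr (_ *m _); apply/matrixP => i j.
have := svalP (cid (artin_schreier ((invmx G *m E) i j))).
by rewrite !mxE -pFrobenius_autE.
Qed.

End Lang.

(** * Free modules *)

Section Coordinates.
Variables (R : comNzRingType) (M : lmodType R) (I : finType) (b : I -> M).
Hypothesis hb : is_basis b.

Lemma basis_ex x : exists a : {ffun I -> R}, x = \sum_i a i *: b i.
Proof. by have [a [aE _]] := hb.2 x Logic.I; exists a. Qed.

Definition coord x : I -> R := sval (cid (basis_ex x)).

Lemma coord_sum x : x = \sum_i coord x i *: b i.
Proof. exact: svalP (cid (basis_ex x)). Qed.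

Lemma coord_uniq x (a : I -> R) : x = \sum_i a i *: b i -> coord x = a.
Proof.
move=> aE; have [a' [_ uniq_a]] := hb.2 x Logic.I.
have e : a' = [ffun i => a i].
  by apply: uniq_a; rewrite aE; apply: eq_bigr => i _; rewrite ffunE.
have e' : a' = sval (cid (basis_ex x)) by apply: uniq_a; apply: coord_sum.
by apply/funext => i; rewrite /coord -e' e ffunE.
Qed.

Lemma coordP a x y i : coord (a *: x + y) i = a * coord x i + coord y i.
Proof.
rewrite (@coord_uniq _ (fun i => a * coord x i + coord y i)) //.
rewrite {1}[x]coord_sum {1}[y]coord_sum scaler_sumr -big_split; apply: eq_bigr => j _.
by rewrite scalerDl scalerA.
Qed.

Lemma coordD x y i : coord (x + y) i = coord x i + coord y i.
Proof. by rewrite -[x in LHS]scale1r coordP mul1r. Qed.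

Lemma coord0 i : coord 0 i = 0.
Proof. by apply: (addrI (coord 0 i)); rewrite -coordD !addr0. Qed.

Lemma coordZ a x i : coord (a *: x) i = a * coord x i.
Proof. by rewrite -[_ *: _]addr0 coordP coord0 addr0. Qed.

Lemma coordN x i : coord (- x) i = - coord x i.
Proof. by rewrite -scaleN1r coordZ mulN1r. Qed.

Lemma coordB x y i : coord (x - y) i = coord x i - coord y i.
Proof. by rewrite coordD coordN. Qed.

Lemma coord_bigsum (J : Type) (r : seq J) (P : pred J) (F : J -> M) i :
  coord (\sum_(j <- r | P j) F j) i = \sum_(j <- r | P j) coord (F j) i.
Proof.
by apply: (big_morph (coord^~ i)); [move=> x y; apply: coordD | apply: coord0].
Qed.

Lemma coord_basis i j : coord (b j) i = (i == j)%:R.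
Proof.
rewrite (@coord_uniq _ (fun i => (i == j)%:R)) //.
rewrite (bigD1 j) //= eqxx scale1r big1 ?addr0 // => l /negPf->.
by rewrite scale0r.
Qed.

Lemma coord_inj x y : coord x =1 coord y -> x = y.
Proof.
by move=> xy; rewrite [x]coord_sum [y]coord_sum; apply: eq_bigr => i _; rewrite xy.
Qed.

Lemma coord_comb (a : I -> R) : coord (\sum_i a i *: b i) = a.
Proof. exact: coord_uniq. Qed.

Lemma in_pow_coord q s x : in_pow q s x <-> forall i, pow_dvd q s (coord x i).
Proof.
split=> [[y ->] i|h]; first by exists (coord y i); rewrite coordZ.
exists (\sum_i sval (cid (h i)) *: b i); apply: coord_inj => i.
by rewrite coordZ coord_comb; apply: svalP (cid (h i)).
Qed.

End Coordinates.

Lemma basis_by_coord (R : comNzRingType) (M : lmodType R) (I : finType) (b : I -> M)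
    (co : M -> I -> R) :
    (forall x, x = \sum_i co x i *: b i) ->
    (forall a : I -> R, co (\sum_i a i *: b i) =1 a) ->
  is_basis b.
Proof.
move=> coE coK; split=> // x _; exists [ffun i => co x i]; split.
  by rewrite {1}[x]coE; apply: eq_bigr => i _; rewrite ffunE.
by move=> a ->; apply/ffunP => i; rewrite ffunE coK.
Qed.

Lemma basis_change (R : comUnitRingType) (M : lmodType R) r (b : 'I_r -> M)
    (G : 'M[R]_r) :
    is_basis b -> G \in unitmx ->
  is_basis (fun j => \sum_i G i j *: b i).
Proof.
move=> hb uG; pose cv x := \col_i coord hb x i.
have cvE x i : coord hb x i = cv x i 0 by rewrite mxE.
have sumE (a : 'cV_r) : cv (\sum_j a j 0 *: (\sum_i G i j *: b i)) = G *m a.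
  apply/colP => i; rewrite !mxE coord_bigsum; apply: eq_bigr => j _.
  by rewrite coordZ coord_comb mulrC.
apply: (@basis_by_coord _ _ _ _ (fun x j => (invmx G *m cv x) j 0)) => [x|a j].
  apply: (coord_inj (hb := hb)) => i; rewrite [RHS]cvE.
  by rewrite (sumE (invmx G *m cv x)) mulKVmx // mxE.
have -> : \sum_i a i *: (\sum_l G l i *: b l) =
    \sum_i (\col_i a i) i 0 *: (\sum_l G l i *: b l).
  by apply: eq_bigr => i _; rewrite mxE.
by rewrite sumE mulKmx // mxE.
Qed.

Section PowersInModules.
Variables (R : comNzRingType) (M : lmodType R) (q : nat).
Implicit Types x y : M.
Local Notation dvd := (@in_pow R M q).

Lemma in_pow0 N : dvd N 0. Proof. by exists 0; rewrite scaler0. Qed.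
Lemma in_powD N x y : dvd N x -> dvd N y -> dvd N (x + y).
Proof. by move=> [x' ->] [y' ->]; exists (x' + y'); rewrite scalerDr. Qed.
Lemma in_powZ K N a x : pow_dvd q K a -> dvd N x -> dvd (K + N) (a *: x).
Proof. by move=> [a' ->] [y ->]; exists (a' *: y); rewrite !scalerA exprD mulrAC. Qed.
Lemma in_pow_le K N x : (K <= N)%N -> dvd N x -> dvd K x.
Proof.
by move=> KN [y ->]; exists (q%:R ^+ (N - K) *: y); rewrite scalerA -exprD subnKC.
Qed.
Lemma in_pow_all x : dvd 0 x. Proof. by exists x; rewrite expr0 scale1r. Qed.
Lemma in_pow_sum (I : Type) (r : seq I) (P : pred I) (F : I -> M) N :
  (forall i, P i -> dvd N (F i)) -> dvd N (\sum_(i <- r | P i) F i).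
Proof. by move=> h; apply: big_ind => //; [apply: in_pow0 | apply: in_powD]. Qed.

End PowersInModules.

Lemma mnm_low_seq n d : exists2 S : seq 'X_{1..n}, uniq S &
  forall m, (m \in S) = (mdeg m < d)%N.
Proof.
exists [seq val l | l : 'X_{1..n < d}].
  by rewrite map_inj_uniq ?enum_uniq //; apply: val_inj.
move=> m; apply/mapP/idP => [[l _ ->]|md]; first exact: bmdeg.
by exists (BMultinom md); rewrite ?mem_enum.
Qed.

(** A sufficiently long partial sum differs from s by a multiple of p^N, and its terms of nonzero
    index are such multiples too. *)
Lemma has_sum_in_pow n (R : comNzRingType) (M : lmodType R) q N
    (u : 'X_{1..n} -> M) s :
    has_sum (@in_pow _ M q) u s -> (forall m, m != 0%MM -> in_pow q N (u m)) ->
  in_pow q N (s - u 0%MM).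
Proof.
move=> hs hu; have [d hd] := hs N; have [S uS Sd] := mnm_low_seq n d.+1.
(* The bound [d.+1] ensures that the index 0 belongs to S even if d = 0. *)
have {}hd := hd S uS (fun m md => eq_trans (Sd m) (ltnW md : (mdeg m < d.+1)%N)).
have S0 : 0%MM \in S by rewrite Sd mdeg0.
move: hd; rewrite (bigD1_seq 0%MM) //= opprD addrA => hd.
rewrite -[s - _](subrK (\sum_(m <- S | m != 0%MM) u m)).
by apply: in_powD => //; apply: in_pow_sum.
Qed.

(** * The change of lift *)

Section Base.
Variables (p n : nat) (k : closedFieldType).
Hypothesis hp : p \in [pchar k].
Variable W : witt_ring p k.
Let p_pr : prime p := pcharf_prime hp.
Local Notation A := {mps W[n]}.

Lemma mps_pow_dvd N (f : A) : pow_dvd p N f <-> forall m, pow_dvd p N (f m).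
Proof.
have pE s (g : A) m : (p%:R ^+ s * g) m = p%:R ^+ s * g m.
  by rewrite -!natrX mps_natME.
split=> [[g ->] m|h]; first by exists (g m); rewrite pE.
exists (MPS (fun m => sval (cid (h m)))); apply/mpsP => m.
by rewrite pE; apply: svalP (cid (h m)).
Qed.

Lemma mps_separated (f : A) : (forall N, pow_dvd p N f) -> f = 0.
Proof.
move=> h; apply/mpsP => m; apply: (witt_separated (W := W)) => N.
by have /mps_pow_dvd := h N.
Qed.

Lemma mpsC_pow_dvd N (w : W) : pow_dvd p N w -> pow_dvd p N (mpsC n w : A).
Proof.
move=> hw; apply/mps_pow_dvd => m /=; case: (m == 0%MM) => //=.
by rewrite mulr0n; apply: pow_dvd0.
Qed.

Lemma frob_lift_congr (phi psi : frob_lift n W) f : pow_dvd p 1 (phi f - psi f).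
Proof.
have [c cE] : exists c, phi f - psi f = p%:R * c by apply: redA_eq; rewrite !lift_modp.
by exists c; rewrite cE expr1.
Qed.

(** The minima of m_j and p - 1 add up to at least the minimum of |m| and p - 1: either some m_j
    reaches p - 1, or every minimum is m_j. *)
Lemma chi_coef_dvd (phi psi : frob_lift n W) m :
  pow_dvd p (minn (mdeg m) p.-1) (chi_coef phi psi m).
Proof.
apply: (@pow_dvd_le _ _ _ (\sum_(j < n) minn (m j) p.-1)).
  have [[j mj]|h] := pselect (exists j, (p.-1 <= m j)%N).
    rewrite (bigD1 j) //= (minn_idPr mj); apply: leq_trans (geq_minr _ _) (leq_addr _ _).
  rewrite mdegE (leq_trans (geq_minl _ _)) //; apply: leq_sum => j _.
  rewrite leq_min leqnn /=; apply/ltnW; rewrite ltnNge; apply/negP => hj.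
  by apply: h; exists j.
apply: pow_dvd_prod => j _; rewrite -[minn _ _]addn0.
apply: pow_dvdM; last exact: pow_dvd_all.
by apply: mpsC_pow_dvd; case: (exact_quot_fact_dvd hp W (m j)).
Qed.

Lemma chi_coef0 (phi psi : frob_lift n W) : chi_coef phi psi 0%MM = 1.
Proof.
rewrite /chi_coef big1 // => j _; rewrite mnm0E expr0 mulr1.
have [_] := exact_quot_fact_dvd hp W 0; rewrite fact0 mul1r expr0 => ->.
by apply/mpsP => m; rewrite mps1E.
Qed.

(** Multiplication by m! clears both exact quotients and leaves a monomial in the constant terms,
    the form in which chi is compared with a substitution. *)
Lemma chi_coef_cst (phi psi : frob_lift n W) (m : 'X_{1..n}) :
  (\prod_(j < n) (m j)`!)%:R * chi_coef phi psi m 0%MM =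
  \prod_(j < n) (phi (mpsX W j) - psi (mpsX W j)) 0%MM ^+ m j.
Proof.
rewrite natr_prod -[chi_coef _ _ _ _]/(mps_cst _) rmorph_prod -big_split.
apply: eq_bigr => j _; set d := phi _ - psi _.
have dE : p%:R * exact_quot d p%:R = d.
  apply: exact_quotK; have [c cE] := frob_lift_congr phi psi (mpsX W j).
  by exists c; rewrite -[d]/(phi _ - psi _) cE expr1.
rewrite rmorphM rmorphXn -[d 0%MM]/(mps_cst d) -{2}dE rmorphM rmorph_nat exprMn.
rewrite [LHS]mulrA.
have [_ e] := exact_quot_fact_dvd hp W (m j); rewrite -[in RHS]e; congr (_ * _ * _).
exact: mpsC0E.
Qed.

Lemma conn_iter0 (H : lmodType A) (D : H -> {ffun 'I_n -> H}) x :
  conn_iter D 0%MM x = x.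
Proof.
rewrite /conn_iter; elim: (enum _) => //= i s ->; by rewrite mnm0E.
Qed.

Section Connection.
Variables (H : lmodType A) (D : H -> {ffun 'I_n -> H}).
Hypothesis Dcomm : forall i j x, D (D x j) i = D (D x i) j.

Lemma conn_iter_conn m l x : conn_iter D m (D x l) = D (conn_iter D m x) l.
Proof.
rewrite /conn_iter; elim: (enum _) => //= i s ->.
by elim: (m i) => //= d ->; rewrite Dcomm.
Qed.

Lemma conn_iterS m l x : conn_iter D (m + U_(l))%MM x = conn_iter D m (D x l).
Proof.
rewrite conn_iter_conn /conn_iter; have := enum_uniq 'I_n.
have := mem_enum 'I_n l; rewrite inE.
elim: (enum _) => //= i s IH; rewrite inE mnmDE mnm1E.
have [li _ /andP[ls _]|li /= ls /andP[_ us]] := eqVneq l i.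
  rewrite li addn1 /=; congr (D (iter _ _ _) _).
  elim: s ls {IH} => //= j s IH; rewrite inE negb_or => /andP[lj ls].
  by rewrite IH // mnmDE mnm1E (negPf lj) addn0.
rewrite addn0 IH //; elim: (m i) => //= d ->; exact: Dcomm.
Qed.

Lemma conn_iter_stable (P : H -> Prop) m x :
  (forall y i, P y -> P (D y i)) -> P x -> P (conn_iter D m x).
Proof.
move=> DP Px; rewrite /conn_iter; elim: (enum _) => //= i s IH.
by elim: (m i) => //= d; apply: DP.
Qed.

(** The form in which Griffiths transversality is iterated; truncated subtraction suits a filtration
    whose step 0 is everything. *)
Lemma conn_iter_drop (F : nat -> H -> Prop) i m x :
    (forall j y l, F j y -> F j.-1 (D y l)) -> F i x ->
  F (i - mdeg m)%N (conn_iter D m x).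
Proof.
move=> DF Fx; rewrite mdegE -big_enum /conn_iter /=.
elim: (enum _) => [|j s IH] /=; first by rewrite big_nil subn0.
rewrite big_cons addnC subnDA; elim: (m j) => [|d IHd] /=; first by rewrite subn0.
by rewrite subnS; apply: DF.
Qed.

End Connection.
End Base.

(** * Unit F-crystals *)

Section FixedMatrices.
Variables (p n : nat) (k : closedFieldType).
Hypothesis hp : p \in [pchar k].
Variable W : witt_ring p k.
Local Notation A := {mps W[n]}.
Local Notation sigma := (wfrob W).

Definition mx_dvd (R : comNzRingType) q s r1 r2 (X : 'M[R]_(r1, r2)) :=
  forall i j, pow_dvd q s (X i j).

Lemma mx_dvdM (R : comNzRingType) q s r1 r2 r3
    (B : 'M[R]_(r1, r2)) (X : 'M[R]_(r2, r3)) :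
  mx_dvd q s X -> mx_dvd q s (B *m X).
Proof.
by move=> hX i j; rewrite mxE; apply: pow_dvd_sum => l _; apply: pow_dvdMl.
Qed.

Lemma map_wres_frob r1 r2 (X : 'M[W]_(r1, r2)) :
  map_mx (wres W) (map_mx sigma X) = map_mx (pFrobenius_aut hp) (map_mx (wres W) X).
Proof. by apply/matrixP => i j; rewrite !mxE wfrob_lift pFrobenius_autE. Qed.

Lemma mx_wres_lift r1 r2 (X : 'M[k]_(r1, r2)) :
  exists Y : 'M[W]_(r1, r2), map_mx (wres W) Y = X.
Proof.
exists (\matrix_(i, j) sval (cid (wres_surj W (X i j)))).
by apply/matrixP => i j; rewrite !mxE; apply: svalP (cid (wres_surj W (X i j))).
Qed.

Lemma mx_wres_dvd r1 r2 (X : 'M[W]_(r1, r2)) :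
  map_mx (wres W) X = 0 <-> mx_dvd p 1 X.
Proof.
split=> [/matrixP X0 i j|X0].
  by apply/wres_dvd; have := X0 i j; rewrite !mxE.
by apply/matrixP => i j; rewrite !mxE; apply/wres_dvd.
Qed.

(* Starting from a solution modulo p, each digit is corrected by solving
   Artin-Schreier equations. *)
Lemma witt_frob_fixed r (B : 'M[W]_r) : map_mx (wres W) B \in unitmx ->
  exists2 G : 'M[W]_r, map_mx (wres W) G \in unitmx & B *m map_mx sigma G = G.
Proof.
move=> uB; have [g ug gE] := lang hp uB; have [X0 X0E] := mx_wres_lift g.
pose err (X : 'M[W]_r) := B *m map_mx sigma X - X.
have err0 : mx_dvd p 1 (err X0).
  by apply/mx_wres_dvd; rewrite map_mxB map_mxM map_wres_frob X0E gE subrr.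
have step s (X : 'M[W]_r) : mx_dvd p s (err X) ->
    exists2 Y, mx_dvd p s (Y - X) & mx_dvd p s.+1 (err Y).
  move=> hX; pose E := \matrix_(i, j) sval (cid (hX i j)).
  have EE : err X = p%:R ^+ s *: E.
    by apply/matrixP => i j; rewrite [RHS]mxE [E i j]mxE; apply: svalP (cid (hX i j)).
  (* Replacing X by X + p^s D changes the error p^s E into p^s (E + err D), so D must solve B
     sigma(D) - D = -E modulo p. *)
  have [d dE] := lang_artin_schreier hp (- map_mx (wres W) E) uB.
  have [D DE] := mx_wres_lift d.
  exists (X + p%:R ^+ s *: D).
    by move=> i j; rewrite addrC addKr mxE; exists (D i j).
  have -> : err (X + p%:R ^+ s *: D) = p%:R ^+ s *: (E + err D).
    rewrite /err map_mxD map_mxZ rmorphXn rmorph_nat mulmxDr -scalemxAr opprD addrACA.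
    by rewrite -/(err X) EE -scalerBr -scalerDr.
  have /mx_wres_dvd hE : map_mx (wres W) (E + err D) = 0.
    by rewrite map_mxD map_mxB map_mxM map_wres_frob DE dE subrr.
  by move=> i j; rewrite mxE -addn1; apply: pow_dvdM; [apply: pow_dvd_refl|apply: hE].
(* Approximations are iterated together with the proof of their precision, which is p^(s+1) at stage
   s since [X0] is already a solution modulo p. *)
pose good s := {X : 'M[W]_r | mx_dvd p s.+1 (err X)}.
pose next s (X : good s) : good s.+1 :=
  let e := cid2 (step _ _ (svalP X)) in exist _ (s2val e) (s2valP' e).
pose Xs := fix Xs s : good s := if s is s'.+1 then next s' (Xs s') else exist _ X0 err0.
have XsS s : mx_dvd p s.+1 (sval (Xs s.+1) - sval (Xs s)).
  exact: s2valP (cid2 (step _ _ (svalP (Xs s)))).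
have [Y YX] : exists Y : 'I_r * 'I_r -> W,
    forall s ij, pow_dvd p s (Y ij - sval (Xs s) ij.1 ij.2).
  apply: (@witt_lim _ _ _ _ (fun s ij => sval (Xs s) ij.1 ij.2)) => s [i j].
  by have := XsS s i j; rewrite !mxE => h; apply: pow_dvd_le h.
pose G := \matrix_(i, j) Y (i, j).
have GX s : mx_dvd p s (G - sval (Xs s)).
  by move=> i j; rewrite !mxE; apply: (YX s (i, j)).
have XsE s : map_mx (wres W) (sval (Xs s)) = g.
  elim: s => [//|s IH]; apply/eqP; rewrite -IH -subr_eq0 -map_mxB; apply/eqP.
  by apply/mx_wres_dvd => i j; apply: pow_dvd_le (XsS s i j).
exists G.
  have -> // : map_mx (wres W) G = g.
  by apply/eqP; rewrite -(XsE 1%N) -subr_eq0 -map_mxB; apply/eqP/mx_wres_dvd.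
apply/eqP; rewrite -subr_eq0; apply/eqP/matrixP => i j; rewrite [RHS]mxE.
apply: (witt_separated (W := W)) => N; rewrite -/(err G).
have -> : err G = err (sval (Xs N)) +
    (B *m map_mx sigma (G - sval (Xs N)) - (G - sval (Xs N))).
  rewrite /err map_mxB mulmxBr; set a := B *m map_mx _ G; set b := B *m map_mx _ _.
  by rewrite opprB addrACA [b + _]addrC subrK addKr.
rewrite mxE; apply: pow_dvdD.
  by apply: pow_dvd_le (svalP (Xs N) i j).
rewrite mxE; apply: pow_dvdD; last by rewrite mxE; apply: pow_dvdN; apply: GX.
by apply: mx_dvdM => i' j'; rewrite mxE; apply: rmorph_pow_dvd; apply: GX.
Qed.

Definition mps_res (f : A) : k := wres W (mps_cst f).
HB.instance Definition _ := GRing.RMorphism.copy mps_res (wres W \o @mps_cst n W).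

(** A is local with maximal ideal (p, t), so invertibility is detected on the determinant in k. *)
Lemma mps_res_unit r (G : 'M[A]_r) : map_mx mps_res G \in unitmx -> G \in unitmx.
Proof.
rewrite !unitmxE det_map_mx unitfE => h; apply: mps_unitP.
exact: (witt_unitP (W := W)).
Qed.

Lemma mps_res_dvd f : pow_dvd p 1 f -> mps_res f = 0.
Proof. by move=> /(rmorph_pow_dvd (@mps_cst n W)) /wres_dvd. Qed.

(** Since phi gains a degree only away from the constant term, the iteration imposes the constant
    term [G0], a fixed matrix over W. The relation B(0) sigma(G0) = G0 makes this choice consistent
    with X = B phi(X). *)
Lemma mps_frob_fixed r (B : 'M[A]_r) : map_mx mps_res B \in unitmx ->
  exists2 G : 'M[A]_r, G \in unitmx & B *m map_mx (std_lift n hp W) G = G.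
Proof.
move=> uB; pose phi := std_lift n hp W.
have [|G0 uG0 G0E] := @witt_frob_fixed r (map_mx (@mps_cst n W) B).
  by rewrite -map_mx_comp.
pose Phi (X : 'I_r * 'I_r -> A) (ij : 'I_r * 'I_r) : A :=
  MPS (fun m => if m == 0%MM then G0 ij.1 ij.2 else
                (\sum_l B ij.1 l * phi (X (l, ij.2))) m).
have [X XE] : exists X, X = Phi X.
  apply: mps_fixpoint => -[|d] X Y XY [i j] m md /=.
    by move: md; rewrite ltnS leqn0 mdeg_eq0 => ->.
  case: eqP => // _; rewrite !mps_sumE; apply: eq_bigr => l _.
  apply: mpsM_agree md => // m' md'.
  apply: (@std_lift_agree _ _ _ hp _ d.+1 _ _ _ _ _ md').
    by apply: XY; rewrite mdeg0.
  by move=> m'' md''; apply: XY.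
have XmE i j m : X (i, j) m = if m == 0%MM then G0 i j else
    (\sum_l B i l * phi (X (l, j))) m by rewrite {1}XE.
have X0 i j : X (i, j) 0%MM = G0 i j by rewrite XmE eqxx.
exists (\matrix_(i, j) X (i, j)).
  apply: mps_res_unit; congr (_ \in unitmx): uG0; apply/matrixP => i j.
  by rewrite !mxE /mps_res /mps_cst X0.
apply/matrixP => i j; rewrite mxE [RHS]mxE; apply/mpsP => m; rewrite [RHS]XmE.
transitivity ((\sum_l B i l * phi (X (l, j))) m).
  by rewrite !mps_sumE; apply: eq_bigr => l _; rewrite !mxE.
case: eqP => // ->; rewrite mps_sumE -[in RHS]G0E mxE; apply: eq_bigr => l _.
by rewrite mpsM0E std_lift_cst X0 !mxE.
Qed.

End FixedMatrices.

(** * First consequences of the axioms of an F-crystal *)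

Section FCrystal.
Variables (p n : nat) (k : closedFieldType).
Hypothesis hp : p \in [pchar k].
Variable W : witt_ring p k.
Let p_pr : prime p := pcharf_prime hp.
Local Notation A := {mps W[n]}.
Variables (H : lmodType A) (c : fcrystal_data H).
Hypothesis hF : is_fcrystal c.
Implicit Types (phi psi : frob_lift n W) (x y : H).

Lemma fcrystal_basis : exists (r : nat) (b : 'I_r -> H), is_basis b.
Proof. by case: hF => -[]. Qed.

Lemma connD x y i : conn c (x + y) i = conn c x i + conn c y i.
Proof. by case: hF => -[_ [cD _] _ _] _ _ _ _; rewrite cD ffunE. Qed.

Lemma connZ (a : A) x i : conn c (a *: x) i = mps_deriv i a *: x + a *: conn c x i.
Proof. by case: hF => -[_ [_ cZ] _ _] _ _ _ _; rewrite cZ. Qed.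

Lemma connC i j x : conn c (conn c x j) i = conn c (conn c x i) j.
Proof. by case: hF => -[_ _ cC _] _ _ _ _; rewrite cC. Qed.

Lemma frobD phi x y : frob c phi (x + y) = frob c phi x + frob c phi y.
Proof. by case: hF => _ fP _ _ _; have := fP phi 1 x y; rewrite rmorph1 !scale1r. Qed.

Lemma frob0 phi : frob c phi 0 = 0.
Proof. by apply: (addrI (frob c phi 0)); rewrite -frobD !addr0. Qed.

Lemma frobZ phi (a : A) x : frob c phi (a *: x) = phi a *: frob c phi x.
Proof. by case: hF => _ fP _ _ _; have := fP phi a x 0; rewrite frob0 !addr0. Qed.

Lemma frob_sum phi (I : Type) (r : seq I) (P : pred I) (F : I -> H) :
  frob c phi (\sum_(i <- r | P i) F i) = \sum_(i <- r | P i) frob c phi (F i).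
Proof. exact: (big_morph (frob c phi) (frobD phi) (frob0 phi)). Qed.

Lemma conn_frob phi x i : conn c (frob c phi x) i =
  \sum_(j < n) mps_deriv i (phi (mpsX W j)) *: frob c phi (conn c x j).
Proof. by case: hF. Qed.

Lemma frob_chi phi psi x : has_sum (@in_pow _ H p)
  (fun m => chi_coef phi psi m *: frob c psi (conn_iter (conn c) m x)) (frob c phi x).
Proof. by case: hF. Qed.

Lemma frob_in_pow phi N x : in_pow p N x -> in_pow p N (frob c phi x).
Proof.
move=> [y ->]; exists (frob c phi y); by rewrite frobZ rmorphXn rmorph_nat.
Qed.

Lemma crystal_separated x : (forall N, in_pow p N x) -> x = 0.
Proof.
have [r [b hb]] := fcrystal_basis => hx; apply: (coord_inj (hb := hb)) => i.
rewrite coord0; apply: (mps_separated (W := W)) => N.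
by apply: (iffLR (in_pow_coord hb p N x)).
Qed.

Lemma crystal_pZ_inj N : injective ( *:%R (p%:R ^+ N : A) : H -> H).
Proof.
have [r [b hb]] := fcrystal_basis => x y xy; apply: (coord_inj (hb := hb)) => i.
have := congr1 (fun z => coord hb z i) xy; rewrite !coordZ => /mpsP e.
apply/mpsP => m; have := e m; rewrite -!natrX !mps_natME; apply: mulfI.
by rewrite natrX witt_pX_neq0.
Qed.

(** In the Taylor formula every coefficient of nonzero index is divisible by p. *)
Lemma frob_congr phi psi x : in_pow p 1 (frob c phi x - frob c psi x).
Proof.
have := has_sum_in_pow (N := 1) (frob_chi phi psi x).
rewrite (chi_coef0 hp) conn_iter0 scale1r; apply=> m m0.
rewrite -[1%N]addn0; apply: in_powZ; last exact: in_pow_all.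
apply: pow_dvd_le (chi_coef_dvd hp phi psi m).
by rewrite leq_min lt0n mdeg_eq0 m0 -ltnS prednK ?prime_gt1 // prime_gt0.
Qed.

(* Griffiths transversality puts D^m x in Fil^(i - |m|), so that the term of
   index m is divisible by p^(i - |m|) times p^min(|m|, p-1). *)
Lemma divisible_all_lifts (N : nat) (Fil : nat -> H -> Prop) : (N < p)%N ->
    (forall i x, Fil i.+1 x -> Fil i x) -> (forall x, Fil 0%N x) ->
    (forall i x j, Fil i.+1 x -> Fil i (conn c x j)) ->
    is_divisible c Fil N ->
  forall phi i x, (i <= N)%N -> Fil i x -> in_pow p i (frob c phi x).
Proof.
move=> Np FilS Fil0 FilD [psi hdiv] phi i x iN Fx.
have FilP j y l : Fil j y -> Fil j.-1 (conn c y l).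
  by case: j => [_|j]; [apply: Fil0|apply: FilD].
have hS m : in_pow p i (chi_coef phi psi m *: frob c psi (conn_iter (conn c) m x)).
  (* The bound i <= N <= p - 1 makes this exponent at least i, whether |m| is below or above p -
     1. *)
  apply: (@in_pow_le _ _ _ _ (minn (mdeg m) p.-1 + (i - mdeg m))).
    by lia.
  apply: in_powZ; first exact: chi_coef_dvd.
  apply: hdiv; first by apply: leq_trans (leq_subr _ _) iN.
  exact: conn_iter_drop.
have h := has_sum_in_pow (frob_chi phi psi x) (fun m _ => hS m).
pose u0 := chi_coef phi psi 0%MM *: frob c psi (conn_iter (conn c) 0%MM x).
by rewrite -[frob c phi x](subrK u0); apply: in_powD h (hS _).
Qed.

End FCrystal.

Section UnitFCrystal.
Variables (p n : nat) (k : closedFieldType).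
Hypothesis hp : p \in [pchar k].
Variable W : witt_ring p k.
Local Notation A := {mps W[n]}.

(** Modulo p the lift is f |-> f^p, whose derivative vanishes. *)
Lemma deriv_lift_dvd (phi : frob_lift n W) i f : pow_dvd p 1 (mps_deriv i (phi f)).
Proof.
have [g gE] : exists g, mps_deriv i (phi f) - 0 = p%:R * g; last first.
  by exists g; rewrite expr1 -gE subr0.
apply: redA_eq; rewrite [LHS]mps_map_deriv -/(redA _) lift_modp mps_derivX.
rewrite -mulr_natr; have -> : (p%:R : {mps k[n]}) = 0.
  by apply/mpsP => m; rewrite mpsMnE -[_ *+ p]mulr_natr (pcharf0 hp) mulr0.
by rewrite mulr0; apply/mpsP => m /=; rewrite rmorph0.
Qed.

(* A Frobenius-fixed vector v is horizontal: dv = d(F v) is a combination of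
   F(dv) with coefficients divisible by p, hence is divisible by all p^N. *)
Lemma unit_fcrystal_basis (V : lmodType A) (c : fcrystal_data V) :
    is_unit_fcrystal c ->
  exists (r : nat) (v : 'I_r -> V), [/\ is_basis v,
    forall j, frob c (std_lift n hp W) (v j) = v j &
    forall j l, conn c (v j) l = 0].
Proof.
move=> [hF [psi psi_bij]]; pose phi := std_lift n hp W.
have [r [b hb]] := fcrystal_basis hF.
pose M (chi : frob_lift n W) := \matrix_(i, j) coord hb (frob c chi (b j)) i.
have ME chi j : frob c chi (b j) = \sum_i M chi i j *: b i.
  by rewrite {1}[frob _ _ _](coord_sum hb); apply: eq_bigr => i _; rewrite mxE.
have uMpsi : M psi \in unitmx.
  have [g _ gK] := psi_bij r b hb.
  apply: (proj1 (@mulmx1_unit _ _ (M psi) (\matrix_(i, j) g (b j) i) _)).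
  apply/matrixP => i j; rewrite mxE [RHS]mxE -(coord_basis hb) -[b j in RHS]gK.
  rewrite /frob_lin coord_bigsum; apply: eq_bigr => l _.
  by rewrite !mxE coordZ mulrC.
(* The unit condition is known for the lift psi only; the matrices for two lifts agree modulo p, so
   it passes to t |-> t^p. *)
have Mcongr : map_mx (@mps_res p n k W) (M phi) = map_mx (@mps_res p n k W) (M psi).
  apply/matrixP => i j; apply/eqP; rewrite !mxE -subr_eq0 -rmorphB -coordB; apply/eqP.
  apply: mps_res_dvd; apply: (iffLR (in_pow_coord hb p 1 _)).
  exact: frob_congr.
have [|G uG GE] := @mps_frob_fixed p n k hp W r (M phi).
  by rewrite Mcongr unitmxE det_map_mx rmorph_unit // -unitmxE.
pose v j := \sum_i G i j *: b i.
have vF j : frob c phi (v j) = v j.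
  rewrite /v (frob_sum hF); apply: (coord_inj (hb := hb)) => l.
  rewrite coord_comb -[in RHS]GE mxE coord_bigsum; apply: eq_bigr => i _.
  by rewrite (frobZ hF) coordZ mxE mulrC [in RHS]mxE.
exists r, v; split=> // [|j l]; first exact: basis_change.
apply: (crystal_separated hF) => N; elim: N j l => [|N IH] j l; first exact: in_pow_all.
rewrite -vF (conn_frob hF) -add1n; apply: in_pow_sum => i _.
by apply: in_powZ; [apply: deriv_lift_dvd | apply: frob_in_pow].
Qed.

End UnitFCrystal.

(** * The splitting *)

Section Splitting.
Variables (R : comNzRingType) (M : lmodType R) (N : nat).
Variables (P Fil : nat -> M -> Prop).
Hypothesis P_sub : forall i, is_submodule (P i).
Hypothesis Fil_sub : forall i, is_submodule (Fil i).
Hypothesis P_le : forall i x, P i x -> P i.+1 x.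
Hypothesis P0 : forall x, P 0%N x -> x = 0.
Hypothesis PN : forall x, P N.+1 x.
Hypothesis P_Fil_sum : forall i x, exists u f, [/\ P i u, Fil i f & x = u + f].
Hypothesis P_Fil_disj : forall i x, P i x -> Fil i x -> x = 0.

Lemma submoduleD (Q : M -> Prop) x y : is_submodule Q -> Q x -> Q y -> Q (x + y).
Proof. by move=> [_ h] Qx Qy; have := h 1 x y Qx Qy; rewrite scale1r. Qed.
Lemma submoduleZ (Q : M -> Prop) a x : is_submodule Q -> Q x -> Q (a *: x).
Proof. by move=> [Q0 h] Qx; have := h a x 0 Qx Q0; rewrite addr0. Qed.
Lemma submoduleN (Q : M -> Prop) x : is_submodule Q -> Q x -> Q (- x).
Proof. by move=> hQ Qx; rewrite -scaleN1r; apply: submoduleZ. Qed.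
Lemma submodule_sum (Q : M -> Prop) (I : Type) (r : seq I) (S : pred I)
    (F : I -> M) :
  is_submodule Q -> (forall i, S i -> Q (F i)) -> Q (\sum_(i <- r | S i) F i).
Proof.
move=> hQ h; apply: big_ind => //; first by case: hQ.
by move=> *; apply: submoduleD.
Qed.

Lemma P_mono i j x : (i <= j)%N -> P i x -> P j x.
Proof.
move=> /subnKC<-; elim: (j - i)%N => [|d IH]; first by rewrite addn0.
by rewrite addnS => /IH/P_le.
Qed.

(** [P] is shifted by one: [P i] stands for U_(i-1), so this is the intersection of U_i and
    Fil^i. *)
Definition piece (i : 'I_N.+1) x := P i.+1 x /\ Fil i x.

(** Modular law: if x = u + f with x in [P j.+1] and u in [P j], then f = x - u lies in [P j.+1] as
    well as in [Fil j], so it belongs to the piece j. *)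
Lemma piece_decomp j : (j <= N.+1)%N -> forall x, P j x ->
  exists y : {ffun 'I_N.+1 -> M}, [/\ forall i, piece i (y i),
    forall i : 'I_N.+1, (j <= i)%N -> y i = 0 & x = \sum_i y i].
Proof.
elim: j => [|j IH] jN x Px.
  exists [ffun=> 0]; split=> [i|i _|]; rewrite ?ffunE //.
    by split; [case: (P_sub i.+1) | case: (Fil_sub i)].
  by rewrite (P0 Px) big1 // => i _; rewrite ffunE.
have [u [f [Pu Ff xE]]] := P_Fil_sum j x.
have [y [yP y0 uE]] := IH (ltnW jN) u Pu.
have Pf : P j.+1 f.
  have -> : f = x - u by rewrite xE addrC addKr.
  by apply: submoduleD => //; apply: submoduleN => //; apply: P_le.
exists [ffun i : 'I_N.+1 => if i == j :> nat then f else y i]; split=> [i|i ji|].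
- by rewrite ffunE; case: eqP => [e|_]; [split; rewrite e | apply: yP].
- by rewrite ffunE gtn_eqF // y0 // ltnW.
rewrite xE uE (bigD1 (Ordinal jN)) //= [in RHS](bigD1 (Ordinal jN)) //= ffunE eqxx.
rewrite (y0 (Ordinal jN)) // add0r addrC; congr (_ + _); apply: eq_bigr => i.
by rewrite ffunE -val_eqE /= => /negPf->.
Qed.

(** Components are killed from the top down: the last one is minus a sum of lower components, so it
    lies in [P j] as well as in [Fil j]. *)
Lemma piece_indep (y : {ffun 'I_N.+1 -> M}) :
  (forall i, piece i (y i)) -> \sum_i y i = 0 -> forall i, y i = 0.
Proof.
move=> yP sy.
suff h j : (j <= N.+1)%N ->
    (forall i : 'I_N.+1, (j <= i)%N -> y i = 0) -> forall i, y i = 0.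
  by apply: (h N.+1) => // i; rewrite leqNgt ltn_ord.
elim: j => [|j IH] jN yj; first by move=> i; apply: yj.
apply: IH; first exact: ltnW; move=> i; rewrite leq_eqVlt => /predU1P[ji|]; last exact: yj.
apply: (@P_Fil_disj j); last by have [_] := yP i; rewrite -ji.
have -> : y i = - \sum_(l | l != i) y l.
  by move/eqP: sy; rewrite (bigD1 i) //= addr_eq0 => /eqP.
apply: submoduleN => //; apply: submodule_sum => // l li.
have [lj|jl] := ltnP l j; first by apply: P_mono lj _; case: (yP l).
rewrite yj; first by case: (P_sub j).
by rewrite ltn_neqAle jl andbT ji eq_sym.
Qed.

Lemma piece_direct_sum : is_direct_sum piece.
Proof.
move=> x; have [y [yP _ xE]] := piece_decomp (leqnn _) (PN x).
exists y; split=> // z [zP zE].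
apply/ffunP => i; apply/eqP; rewrite -subr_eq0; apply/eqP.
have := @piece_indep [ffun i => y i - z i] _ _ i; rewrite ffunE; apply=> [l|].
  rewrite ffunE; have [? ?] := yP l; have [? ?] := zP l.
  by split; apply: submoduleD => //; apply: submoduleN.
by under eq_bigr do rewrite ffunE; rewrite sumrB -xE -zE subrr.
Qed.

Lemma piece_sub i : is_submodule (piece i).
Proof.
have [P00 PD] := P_sub i.+1; have [F00 FD] := Fil_sub i.
by split=> [|a x y [? ?] [? ?]]; split=> //; [apply: PD | apply: FD].
Qed.

Section Basis.
Variables (h : 'I_N.+1 -> nat) (e : forall i, 'I_(h i) -> M).
Hypothesis he : forall i, is_basis_of (piece i) (@e i).
Let b (a : 'I_(\sum_i h i)) : M := e (tagnat.sig2 a).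

Lemma sum_tagnat (G : forall i, 'I_(h i) -> M) :
  \sum_i \sum_m G i m = \sum_a G (tagnat.sig1 a) (tagnat.sig2 a).
Proof. by rewrite sig_big_dep /= (reindex _ tagnat.sig_bij_on). Qed.

Let bRank i m : b (tagnat.Rank i m) = e m.
Proof.
rewrite /b /tagnat.sig2 /tagnat.Rank.
(* A function of the tagged pair avoids casts between ordinals whose bounds depend on the block. *)
pose et (q : {i & 'I_(h i)}) := e (tagged q).
by rewrite -[LHS]/(et (tagnat.sig (tagnat.rank (Tagged _ m)))) tagnat.rankK.
Qed.

Lemma piece_basis : is_basis b.
Proof.
split=> // x _; have [y [[yP xE] yU]] := piece_direct_sum x.
have ex i : exists a : {ffun 'I_(h i) -> R}, y i = \sum_m a m *: e m.
  by have [a [aE _]] := (he i).2 _ (yP i); exists a.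
pose al i := sval (cid (ex i)).
have alE i : y i = \sum_m al i m *: e m := svalP (cid (ex i)).
exists [ffun a => al (tagnat.sig1 a) (tagnat.sig2 a)]; split.
  rewrite {1}xE (eq_bigr _ (fun i _ => alE i)) (sum_tagnat (fun i m => al i m *: e m)).
  by apply: eq_bigr => a _; rewrite ffunE.
move=> c cE; apply/ffunP => a; rewrite ffunE.
pose z : {ffun 'I_N.+1 -> M} := [ffun i => \sum_m c (tagnat.Rank i m) *: e m].
have yz : y = z.
  apply: yU; split=> [i|].
    rewrite ffunE; apply: submodule_sum; first exact: piece_sub.
    by move=> m _; apply: submoduleZ; [apply: piece_sub | case: (he i)].
  rewrite cE; under [RHS]eq_bigr do rewrite ffunE.
  rewrite (sum_tagnat (fun i m => c (tagnat.Rank i m) *: e m)).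
  by apply: eq_bigr => a' _; rewrite tagnat.sig2K.
set i := tagnat.sig1 a; have [w [_ wU]] := (he i).2 _ (yP i).
have <- : w = al i by apply: wU; apply: alE.
have -> : w = [ffun m => c (tagnat.Rank i m)].
  apply: wU; rewrite yz ffunE; by apply: eq_bigr => m _; rewrite ffunE.
by rewrite ffunE tagnat.sig2K.
Qed.

(** Turns membership in a step of the filtration into block triangularity, because the decomposition
    of x has no component of index j or more. *)
Lemma piece_coord_eq0 (hb : is_basis b) j x a : (j <= N.+1)%N -> P j x ->
  (j <= tagnat.sig1 a)%N -> coord hb x a = 0.
Proof.
move=> jN Px ja; have [y [yP y0 ->]] := piece_decomp jN Px.
rewrite coord_bigsum big1 // => i _; have [ai|ai] := eqVneq (tagnat.sig1 a) i.
  by rewrite y0 ?coord0 // -ai.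
have [al [-> _]] := (he i).2 _ (yP i).
rewrite coord_bigsum big1 // => m _; rewrite coordZ -bRank coord_basis.
case: eqP => [am|_]; last by rewrite mulr0.
by move: ai; rewrite am tagnat.Rank1K eqxx.
Qed.

End Basis.
End Splitting.

(** * The conjugate and Hodge filtrations of an ordinary Hodge F-crystal *)

Section Ordinary.
Variables (p n : nat) (k : closedFieldType).
Hypothesis hp : p \in [pchar k].
Variable W : witt_ring p k.
Local Notation A := {mps W[n]}.
Variables (H : lmodType A) (c : fcrystal_data H).
Hypothesis hF : is_fcrystal c.

(* b = s + p y expresses s through b by a matrix congruent to 1 modulo p. *)
Lemma nakayama (S : H -> Prop) : is_submodule S ->
  (forall x, exists s y, S s /\ x = s + p%:R *: y) -> forall x, S x.
Proof.
move=> hS ex; have [r [b hb]] := fcrystal_basis hF.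
have {}ex j : exists s, S s /\ exists y, b j = s + p%:R *: y.
  by have [s [y [Ss e]]] := ex (b j); exists s; split=> //; exists y.
pose s j := sval (cid (ex j)).
have sS j : S (s j) by case: (svalP (cid (ex j))).
have sE j : exists y, b j = s j + p%:R *: y by case: (svalP (cid (ex j))).
pose y j := sval (cid (sE j)); have yE j : b j = s j + p%:R *: y j := svalP (cid (sE j)).
pose G : 'M[A]_r := \matrix_(i, j) coord hb (s j) i.
have uG : G \in unitmx.
  apply: mps_res_unit; suff -> : map_mx (@mps_res p n k W) G = 1%:M by apply: unitmx1.
  apply/matrixP => i j; rewrite !mxE.
  have -> : s j = b j - p%:R *: y j by rewrite yE addrK.
  rewrite coordB coord_basis coordZ rmorphB rmorphM !rmorph_nat.
  by rewrite (pcharf0 hp) mul0r subr0.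
move=> x; have hs := basis_change hb uG; rewrite (coord_sum hs x).
apply: submodule_sum => // j _; apply: submoduleZ => //.
suff -> : \sum_i G i j *: b i = s j by [].
by rewrite [RHS](coord_sum hb); apply: eq_bigr => i _; rewrite mxE.
Qed.

Variables (phi0 : frob_lift n W) (N : nat).
Hypothesis hlevel : level_le c phi0 N.
Hypothesis hord : is_ordinary c phi0.
Variable U : nat -> H -> Prop.
Hypothesis hU : is_ordinary_filtration c phi0 U.
Variable Fil : nat -> H -> Prop.
Hypothesis hFil : is_hodge_filtration c phi0 Fil.

Lemma U_sub i : is_submodule (U i).
Proof.
case: hU => /(_ i) [V [cV [j [_ _ UE _ _]]]] _ _ _; split.
  by apply/UE; exists 0; rewrite linear0.
move=> a x y /UE[v <-] /UE[w <-]; apply/UE; exists (a *: v + w); exact: linearP.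
Qed.

Lemma U_conn i x l : U i x -> U i (conn c x l).
Proof.
case: hU => /(_ i) [V [cV [j [_ _ UE Dj _]]]] _ _ _ /UE[v <-]; apply/UE.
by exists (conn cV v l).
Qed.

Lemma U_frob i phi x : U i x -> U i (frob c phi x).
Proof.
case: hU => /(_ i) [V [cV [j [_ _ UE _ Fj]]]] _ _ _ /UE[v <-]; apply/UE.
by exists (frob cV phi v).
Qed.

Local Notation P := (prev_step U).

Lemma prev_sub i : is_submodule (P i).
Proof.
by case: i => [|i]; [split=> [//|a x y -> ->] /=; rewrite scaler0 addr0 | apply: U_sub].
Qed.

Lemma prev_le i x : P i x -> P i.+1 x.
Proof.
case: i => [-> /=|i]; first by case: (U_sub 0).
by case: hU => _ h _ _; apply: h.
Qed.

Lemma Fil_submod i : is_submodule (Fil i).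
Proof. by case: hFil => _ _ /(_ i) [r []]. Qed.

Lemma U_red i : reduces_to (U i) (conj_fil c phi0 i).
Proof. by case: hU. Qed.
Lemma Fil_red i : reduces_to (Fil i) (hodge_fil c phi0 i).
Proof. by case: hFil. Qed.

Lemma red0 : red (0 : H) = 0.
Proof. by apply: (addrI (red (0 : H))); rewrite -redD !addr0. Qed.

Lemma red_add_decomp (x u f : H) : red x = red u + red f ->
  exists y, x = u + f + p%:R *: y.
Proof. by rewrite -redD => /red_eq[z xz]; exists z; rewrite -xz addrC subrK. Qed.

(** The level condition gives this modulo p, and [nakayama] lifts it. *)
Lemma prev_all x : P N.+1 x.
Proof.
move: x; apply: nakayama => [|x]; first exact: U_sub.
have [u Uu ux] := (iffLR ((U_red N).1 (red x))) (hlevel.1 (red x)).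
have [|y yE] := @red_add_decomp x u 0; first by rewrite red0 addr0 ux.
by exists u, y; rewrite yE addr0.
Qed.

(** For i = 0 the Hodge step is everything; otherwise the splitting of H_0 given by ordinarity is
    lifted by [nakayama]. *)
Lemma prev_Fil_sum i x : exists u f, [/\ P i u, Fil i f & x = u + f].
Proof.
case: i => [|i].
  by exists 0, x; split; rewrite ?add0r //; case: hFil.
pose S x := exists u f, [/\ U i u, Fil i.+1 f & x = u + f].
suff : forall x, S x by apply.
apply: nakayama => [|{}x].
  split.
    exists 0, 0; split; [by case: (U_sub i) | by case: (Fil_submod i.+1) |].
    by rewrite addr0.
  move=> a ? ? [u [f [Uu Ff ->]]] [u' [f' [Uu' Ff' ->]]].
  exists (a *: u + u'), (a *: f + f'); split; last by rewrite scalerDr addrACA.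
    by case: (U_sub i) => _; apply.
  by case: (Fil_submod i.+1) => _; apply.
have [[u0 f0] [[/= u0U f0F xE] _]] := hord.2 i (red x).
have [u Uu uE] := iffLR ((U_red i).1 _) u0U.
have [f Ff fE] := iffLR ((Fil_red i.+1).1 _) f0F.
have [|y yE] := @red_add_decomp x u f; first by rewrite uE fE.
by exists (u + f), y; split=> //; exists u, f.
Qed.

(** Directness modulo p gives red x = 0. Then x = p y = p y' with y in U and y' in Fil; as H has no
    p-torsion, y = y' is again in both, so x is divisible by every power of p. *)
Lemma prev_Fil_disj i x : P i x -> Fil i x -> x = 0.
Proof.
case: i => [//|i] /= Ux Fx; apply: (crystal_separated hF) => M.
elim: M x Ux Fx => [|M IH] x Ux Fx; first exact: in_pow_all.
have x0 : red x = 0.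
  have [z [_ zU]] := hord.2 i (red x).
  have e1 : z = (red x, 0).
    apply: zU; split; rewrite /= ?addr0 //; first by apply/(U_red i).1; exists x.
    by apply/(Fil_red i.+1).1; exists 0; rewrite ?red0 //; case: (Fil_submod i.+1).
  have e2 : z = (0, red x).
    apply: zU; split; rewrite /= ?add0r //; last by apply/(Fil_red i.+1).1; exists x.
    by apply/(U_red i).1; exists 0; rewrite ?red0 //; case: (U_sub i).
  by move: e2; rewrite e1 => -[].
have [y Uy xy] := (U_red i).2 _ Ux x0.
have [y' Fy' xy'] := (Fil_red i.+1).2 _ Fx x0.
have e : (p%:R ^+ 1 : A) *: y = p%:R ^+ 1 *: y' by rewrite !expr1 -xy.
have yy' := crystal_pZ_inj hF e.
rewrite xy -add1n; apply: in_powZ; first by exists 1; rewrite mulr1 expr1.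
by apply: IH => //; rewrite yy'.
Qed.

(** The horizontal Frobenius-fixed basis of V_i is lifted to U_i, and dropping the component in
    U_(i-1) moves the lift into Fil^i. The quotient map is injective on the piece because its kernel
    U_(i-1) meets Fil^i trivially. *)
Lemma piece_flat_basis (i : 'I_N.+1) :
  exists r (e : 'I_r -> H), [/\ is_basis_of (piece P Fil i) e,
    forall m, P i (frob c (std_lift n hp W) (e m) - p%:R ^+ i *: e m) &
    forall m l, P i (conn c (e m) l)].
Proof.
have [V [cV [uV [q [qL qS q0 qD qF]]]]] : exists (V : lmodType A) (cV : fcrystal_data V),
  is_unit_fcrystal cV /\ is_quot_iso c (U i) (P i) (tate_twist cV i) by case: hU.
have [r [v [hv vF vD]]] := unit_fcrystal_basis hp uV.
have ex m : exists x, piece P Fil i x /\ q x = v m.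
  have [x Ux qx] := qS (v m); have [u [f [Pu Ff xE]]] := prev_Fil_sum i x.
  have Uu : U i u := prev_le Pu.
  have fE : f = -1 *: u + x by rewrite xE scaleN1r addKr.
  have Uf : U i f by rewrite fE; case: (U_sub i) => _; apply.
  by exists f; do ?split => //; rewrite fE qL // (iffRL (q0 u Uu)) // scaler0 add0r.
pose e m := sval (cid (ex m)).
have [eP qe] : (forall m, piece P Fil i (e m)) /\ (forall m, q (e m) = v m).
  by split=> m; case: (svalP (cid (ex m))).
have eU m : U i (e m) by case: (eP m).
have U0 : U i 0 by case: (U_sub i).
have qZ0 : q 0 = 0 by apply/q0 => //; case: (prev_sub i).
have qD2 x y : U i x -> U i y -> q (x + y) = q x + q y.
  by move=> Ux Uy; have := qL 1 x y Ux Uy; rewrite !scale1r.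
have qZ a x : U i x -> q (a *: x) = a *: q x.
  by move=> Ux; have := qL a x 0 Ux U0; rewrite qZ0 !addr0.
have UZ a x : U i x -> U i (a *: x) by apply: submoduleZ; apply: U_sub.
have qsum (a : 'I_r -> A) : U i (\sum_m a m *: e m) /\
    q (\sum_m a m *: e m) = \sum_m a m *: v m.
  apply: (big_ind2 (fun x y => U i x /\ q x = y)) => //
    [x1 x2 y1 y2 [Ux <-] [Uy <-]|m _].
    by split; [apply: submoduleD => //; apply: U_sub | apply: qD2].
  by rewrite -qe -qZ //; split=> //; apply: UZ.
exists r, e; split=> [|m|m l].
- split=> // x [Ux Fx]; exists [ffun m => coord hv (q x) m]; split.
    apply/eqP; rewrite -subr_eq0; apply/eqP; set y := \sum_m _.
    have [Uy qy] := qsum (fun m => [ffun m => coord hv (q x) m] m).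
    have Uxy : U i (x - y) by apply: submoduleD (U_sub i) Ux (submoduleN (U_sub i) Uy).
    apply: (@prev_Fil_disj i); last first.
      apply: submoduleD (Fil_submod i) Fx (submoduleN (Fil_submod i) _).
      apply: submodule_sum (Fil_submod i) _ => m _.
      exact: submoduleZ (Fil_submod i) (eP m).2.
    apply/q0 => //; rewrite -scaleN1r addrC qL // qy scaleN1r.
    rewrite [q x in X in _ + X](coord_sum hv).
    by under eq_bigr do rewrite ffunE; rewrite addNr.
  move=> a aE; apply/ffunP => m; rewrite ffunE aE.
  by have [_ ->] := qsum a; rewrite coord_comb.
- have UF := U_frob (std_lift n hp W) (eU m).
  apply/q0.
    exact: submoduleD (U_sub i) UF (submoduleN (U_sub i) (UZ _ _ (eU m))).
  rewrite addrC -scaleN1r (qL _ _ _ (UZ _ _ (eU m)) UF) (qF _ _ (eU m)) (qZ _ _ (eU m)).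
  by rewrite qe /= vF scaleN1r addNr.
apply/q0; first exact: U_conn.
by rewrite qD // qe /= vD.
Qed.

End Ordinary.

(** * Canonical coordinates *)

Section Unipotent.
Variables (p : nat) (k : closedFieldType).
Variable W : witt_ring p k.
Local Notation sigma := (wfrob W).

Lemma wfrob_dvd N (w : W) : pow_dvd p N (sigma w) -> pow_dvd p N w.
Proof.
have [g sK gK] := wfrob_bij W; move=> [v vE]; exists (g v).
by apply: (can_inj sK); rewrite vE rmorphM rmorphXn rmorph_nat gK.
Qed.

(* C is unipotent and C (M P) = P sigma(C), for P = diag(p^lv). *)
Lemma unipotent_frob (I : finType) (lv : I -> nat) (M : I -> I -> W) :
    (forall a b, (lv b <= lv a)%N -> M a b = (a == b)%:R) ->
  exists C : I -> I -> W, [/\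
    forall a b, (lv b <= lv a)%N -> C a b = (a == b)%:R,
    forall a b, pow_dvd p (lv b - lv a) (C a b) &
    forall a b, \sum_c C a c * (p%:R ^+ lv b * M c b) = p%:R ^+ lv a * sigma (C a b)].
Proof.
move=> M1; have [g sK gK] := wfrob_bij W.
(* Writing C a b = p^(lv b - lv a) X(a, b) above the diagonal and dividing the relation by p^(lv b)
   gives sigma(X(a, b)) = rhs X a b. The positive powers of p make it a contraction. *)
pose rhs (X : I * I -> W) a b :=
  M a b + \sum_(c | (lv a < lv c)%N) p%:R ^+ (lv c - lv a) * X (a, c) * M c b.
have [X XE] : exists X : I * I -> W, X = fun ab => g (rhs X ab.1 ab.2).
  apply: (witt_fixpoint (Phi := fun X ab => g (rhs X ab.1 ab.2))) => d X Y XY [a b] /=.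
  apply: wfrob_dvd; rewrite rmorphB !gK /rhs opprD addrACA subrr add0r -sumrB.
  apply: pow_dvd_sum => c ac; rewrite -mulrBl -mulrBr mulrC; apply: pow_dvdMl.
  apply: (@pow_dvd_le _ _ _ (lv c - lv a + d)); first by rewrite -add1n leq_add2r subn_gt0.
  by apply: pow_dvdM; [apply: pow_dvd_refl | apply: XY].
have sX a b : sigma (X (a, b)) = rhs X a b by rewrite {1}XE gK.
pose C a b := if (lv a < lv b)%N then p%:R ^+ (lv b - lv a) * X (a, b) else (a == b)%:R.
have C1 a b : (lv b <= lv a)%N -> C a b = (a == b)%:R by rewrite /C ltnNge => ->.
exists C; split=> // [a b|a b].
  rewrite /C; case: ltnP => [ab|]; first by exists (X (a, b)).
  by rewrite -subn_eq0 => /eqP->; apply: pow_dvd_all.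
have CM : \sum_c C a c * M c b = M a b + \sum_(c | (lv a < lv c)%N) C a c * M c b.
  rewrite (bigID (fun c => (lv a < lv c)%N)) /= addrC; congr (_ + _).
  rewrite (bigD1 a) ?ltnn //= C1 // eqxx mul1r big1 ?addr0 // => c /andP[].
  by rewrite -leqNgt => ca; rewrite eq_sym => /negPf ac; rewrite C1 // ac mul0r.
transitivity (p%:R ^+ lv b * \sum_c C a c * M c b).
  by rewrite mulr_sumr; apply: eq_bigr => c _; rewrite mulrCA.
rewrite CM; have [ab|ba] := ltnP (lv a) (lv b).
  rewrite [C a b]/C ab rmorphM rmorphXn rmorph_nat sX mulrA -exprD subnKC ?(ltnW ab) //.
  congr (_ * (_ + _)); apply: eq_bigr => c ac; by rewrite /C ac.
rewrite C1 // rmorph_nat M1 // big1 ?addr0 => [|c ac]; last first.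
  have bc := leq_ltn_trans ba ac; rewrite M1 ?(ltnW bc) //.
  by case: eqP bc => [->|_]; rewrite ?ltnn ?mulr0.
by case: eqP => [->|_]; rewrite ?mulr0.
Qed.

End Unipotent.

(** * Operations on convergent sums in W[1/p] *)

Section Sums.
Variables (p n : nat) (k : closedFieldType).
Variable W : witt_ring p k.
Local Notation Ku := {fraction W}.
Local Notation nbhK := (fun N (x : Ku) => exists w : W, x = (p%:R ^+ N * w)%:F).
Local Notation hsum := (@has_sum n Ku nbhK).
Implicit Types u v : 'X_{1..n} -> Ku.

Lemma hsum0 : hsum (fun=> 0) 0.
Proof. by move=> N; exists 0%N => S _ _; exists 0; rewrite big1 // subr0 mulr0 rmorph0. Qed.

Lemma hsumD u v s t : hsum u s -> hsum v t -> hsum (fun m => u m + v m) (s + t).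
Proof.
move=> hu hv N; have [d1 h1] := hu N; have [d2 h2] := hv N.
exists (maxn d1 d2) => S uS hS.
have [|w1 e1] := h1 S uS; first by move=> m md; apply: hS; rewrite leq_max md.
have [|w2 e2] := h2 S uS; first by move=> m md; apply: hS; rewrite leq_max md orbT.
by exists (w1 + w2); rewrite big_split opprD addrACA e1 e2 mulrDr rmorphD.
Qed.

Lemma hsum_sum (J : Type) (r : seq J) (P : pred J) (u : J -> 'X_{1..n} -> Ku)
    (s : J -> Ku) :
    (forall j, P j -> hsum (u j) (s j)) ->
  hsum (fun m => \sum_(j <- r | P j) u j m) (\sum_(j <- r | P j) s j).
Proof.
move=> h; elim: r => [|j r IH].
  by rewrite big_nil; have := hsum0; congr (hsum _ _); apply/funext => m; rewrite big_nil.
rewrite big_cons; case: ifP => Pj.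
  have := hsumD (h j Pj) IH.
  by congr (hsum _ _); apply/funext => m; rewrite big_cons Pj.
by have := IH; congr (hsum _ _); apply/funext => m; rewrite big_cons Pj.
Qed.

(** A denominator p^e in a costs e digits, so the original sum is taken to precision N + e. *)
Lemma hsumZ a u s : hsum u s -> hsum (fun m => a * u m) (a * s).
Proof.
move=> hu N; have [w [e aE]] := frac_wittP a; have [d hd] := hu (N + e)%N.
exists d => S uS hS; have [v vE] := hd S uS hS; exists (w * v).
rewrite -mulr_sumr -mulrBr vE aE exprD !rmorphM !rmorphXn !rmorph_nat.
have pe : (p%:R ^+ e : Ku) != 0.
  by rewrite -(rmorph_nat (@FracField.tofrac W)) -rmorphXn tofrac_eq0 witt_pX_neq0.
move: pe; set P := p%:R ^+ N; set E := p%:R ^+ e => pe.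
by rewrite [P * E]mulrC -[E * P * _]mulrA -[w%:F / E * _]mulrA mulKf // mulrCA.
Qed.

(** Reindexing by m |-> m + U_(j), extended by 0; it absorbs the index shift caused by a
    derivative. *)
Lemma hsum_shift j u s : hsum u s ->
  hsum (fun m : 'X_{1..n} => if (0 < m j)%N then u (m - U_(j))%MM else 0) s.
Proof.
move=> hu N; have [d hd] := hu N; exists d.+1 => S uS hS.
pose S' := [seq (m - U_(j))%MM | m <- [seq m : 'X_{1..n} <- S | (0 < m j)%N]].
have subK (m : 'X_{1..n}) : (0 < m j)%N -> (m - U_(j) + U_(j) = m)%MM.
  by move=> mj; rewrite submK // lep1mP -lt0n.
have [||w wE] := hd S'.
- rewrite map_inj_in_uniq ?filter_uniq // => m m'.
  rewrite !mem_filter => /andP[mj _] /andP[mj' _] e.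
  by rewrite -(subK m mj) -(subK m' mj') e.
- move=> m md; apply/mapP; exists (m + U_(j))%MM; last by rewrite addmK.
  by rewrite mem_filter mnmDE mnm1E eqxx addn1 /= hS // mdegD mdeg1 addn1 ltnS.
by exists w; rewrite -wE big_map big_filter [in RHS]big_mkcond.
Qed.

End Sums.

(** * Taylor series of functionals, and their behaviour under Frobenius *)

Section Taylor.
Variables (p n : nat) (k : closedFieldType).
Hypothesis hp : p \in [pchar k].
Variable W : witt_ring p k.
Local Notation A := {mps W[n]}.
Local Notation Ku := {fraction W}.
Local Notation sigma := (wfrob W).
Local Notation std := (std_lift n hp W).
Variables (H : lmodType A) (c : fcrystal_data H).
Hypothesis hF : is_fcrystal c.
Implicit Types (m q : 'X_{1..n}) (x y : H).

Definition mnm_fact m := \prod_(j < n) (m j)`!.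

Lemma mnm_factS m l : mnm_fact (m + U_(l)) = (mnm_fact m * (m l).+1)%N.
Proof.
rewrite /mnm_fact (bigD1 l) //= [in RHS](bigD1 l) //= mnmDE mnm1E eqxx addn1 factS.
rewrite [in RHS]mulnAC [(_`! * (m l).+1)%N]mulnC; congr (_ * _)%N.
by apply: eq_bigr => j jl; rewrite mnmDE mnm1E eq_sym (negPf jl) addn0.
Qed.

Lemma mnm_fact_gt0 m : (0 < mnm_fact m)%N.
Proof. by rewrite prodn_gt0 // => j; rewrite fact_gt0. Qed.

(** The hypothesis covers all degrees up to |m|, since coefficients of products involve every
    smaller index. *)
Lemma mnm_rec (P : 'X_{1..n} -> Prop) : P 0%MM ->
    (forall m l, (forall m', (mdeg m' <= mdeg m)%N -> P m') -> P (m + U_(l))%MM) ->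
  forall m, P m.
Proof.
move=> P0 PS m; have [d] := ubnP (mdeg m); elim: d m => // d IH m md.
have [->//|m0] := eqVneq m 0%MM.
have [l ml] : exists l, m l != 0%N.
  apply/existsP; apply: contra_neqT m0; rewrite negb_exists => /forallP h.
  by apply/mnmP => l; rewrite mnm0E; apply/eqP; have := h l; rewrite negbK.
rewrite -(submK (m := U_(l)) (m' := m)) ?lep1mP //.
apply: PS => m' m'm; apply: IH; apply: leq_ltn_trans m'm _.
move: md; rewrite -{1}(submK (m := U_(l)) (m' := m)) ?lep1mP //.
by rewrite mdegD mdeg1 addn1 ltnS.
Qed.

Lemma mps_coefS (f : {mps Ku[n]}) m l :
  f (m + U_(l))%MM = (m l).+1%:R^-1 * mps_deriv l f m.
Proof.
rewrite mps_derivE -[f _ *+ _]mulr_natl mulKf //.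
exact: frac_nat_neq0.
Qed.

Section OneFunctional.
Variable ell : H -> W.
Hypothesis ellD : forall x y, ell (x + y) = ell x + ell y.
Hypothesis ellZ : forall (a : A) x, ell (a *: x) = a 0%MM * ell x.

(* When ell is the value of a coordinate at t = 0, this is the same coordinate
   in the basis of horizontal sections. *)
Definition taylor x : {mps Ku[n]} :=
  MPS (fun m => (ell (conn_iter (conn c) m x))%:F / (mnm_fact m)%:R).

Lemma conn_iterD m x y :
  conn_iter (conn c) m (x + y) = conn_iter (conn c) m x + conn_iter (conn c) m y.
Proof.
rewrite /conn_iter; elim: (enum _) => //= i s ->.
by elim: (m i) => //= d ->; apply: (connD hF).
Qed.

Lemma taylorD x y : taylor (x + y) = taylor x + taylor y.
Proof.
by apply/mpsP => m; rewrite mpsDE /= conn_iterD ellD rmorphD mulrDl.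
Qed.

Lemma taylor0 : taylor 0 = 0.
Proof. by apply: (addrI (taylor 0)); rewrite -taylorD !addr0. Qed.

Lemma taylor_sum (I : Type) (r : seq I) (P : pred I) (F : I -> H) :
  taylor (\sum_(i <- r | P i) F i) = \sum_(i <- r | P i) taylor (F i).
Proof. exact: (big_morph taylor taylorD taylor0). Qed.

Lemma taylor_deriv l x : mps_deriv l (taylor x) = taylor (conn c x l).
Proof.
apply/mpsP => m; rewrite mps_derivE /= conn_iterS; last by apply: (connC hF).
rewrite mnm_factS natrM invfM -[_ *+ _]mulr_natr -mulrA divfK //.
exact: frac_nat_neq0.
Qed.

Lemma taylor_cst x : taylor x 0%MM = (ell x)%:F.
Proof.
by rewrite /= conn_iter0 /mnm_fact big1 ?divr1 // => j _; rewrite mnm0E fact0.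
Qed.

(* Both sides have the same constant term, and their difference u(a, x)
   satisfies d_l u(a, x) = u(d_l a, x) + u(a, D_l x). *)
Lemma taylorZ (a : A) x : taylor (a *: x) = @embK p n k W a * taylor x.
Proof.
apply/mpsP => m; elim/mnm_rec: m a x => [a x|m l IH a x].
  by rewrite mpsM0E !taylor_cst ellZ rmorphM.
rewrite !mps_coefS mps_derivM taylor_deriv (connZ hF) taylorD !mpsDE !IH //.
by rewrite /embK mps_map_deriv -taylor_deriv.
Qed.

Variable j : nat.
Hypothesis ell_frob : forall x, ell (frob c std x) = p%:R ^+ j * sigma (ell x).

Let pj_neq0 : (p%:R ^+ j : Ku) != 0.
Proof.
by rewrite -(rmorph_nat (@FracField.tofrac W)) -rmorphXn tofrac_eq0 witt_pX_neq0.
Qed.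

Variable psi : frob_lift n W.
Let mon q : A := \prod_(i < n) psi (mpsX W i) ^+ q i.

(** The expected value of psi(taylor x): as the functional carries F to p^j sigma, the series of
    F(psi) psi^* x should be p^j times it. *)
Definition taylor_frob x : {mps Ku[n]} :=
  mpsC n (p%:R ^+ j)^-1 * taylor (frob c psi x).

Lemma ell_sum (r : seq 'X_{1..n}) (F : 'X_{1..n} -> H) :
  ell (\sum_(m <- r) F m) = \sum_(m <- r) ell (F m).
Proof.
by apply: (big_morph ell ellD); have := ellZ 0 0; rewrite scale0r mps0E mul0r.
Qed.

(** The functional is applied to the expansion of F(psi) psi^* x by chi(psi, std). As std(t_i) has
    no constant term, the coefficient of index q at t = 0 is psi(t)(0)^q / q!, which matches the
    factorial in [taylor]. *)
Lemma taylor_frob_cst x :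
  has_sum (fun N (y : Ku) => exists w : W, y = (p%:R ^+ N * w)%:F)
    (fun q => frobK (taylor x q) * (mon q 0%MM)%:F) (taylor_frob x 0%MM).
Proof.
rewrite mpsCME taylor_cst.
pose u q : Ku :=
  (chi_coef psi std q 0%MM * ell (frob c std (conn_iter (conn c) q x)))%:F.
have hu : has_sum (fun N (y : Ku) => exists w : W, y = (p%:R ^+ N * w)%:F) u
    (ell (frob c psi x))%:F.
  move=> N; have [d hd] := frob_chi hF psi std x N; exists d => S uS hS.
  have [y yE] := hd S uS hS; exists (ell y).
  have -> : frob c psi x = p%:R ^+ N *: y +
      \sum_(m <- S) chi_coef psi std m *: frob c std (conn_iter (conn c) m x).
    by rewrite -yE subrK.
  rewrite ellD ell_sum ellZ rmorphD rmorph_sum /=.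
  under eq_bigr do rewrite ellZ.
  by rewrite addrK -[_ 0%MM]/(mps_cst _) rmorphXn rmorph_nat.
have := hsumZ (p%:R ^+ j)^-1 hu; congr (has_sum _ _ _); apply/funext => q.
rewrite /u ell_frob mulrCA rmorphM rmorphXn rmorph_nat mulKf // {u hu}.
have fq : (mnm_fact q)%:R != 0 :> W by apply: (witt_nat_neq0 hp); apply: mnm_fact_gt0.
rewrite /= -[(mnm_fact q)%:R](rmorph_nat (@FracField.tofrac W)) frobK_div // rmorph_nat.
have -> : mon q 0%MM = (mnm_fact q)%:R * chi_coef psi std q 0%MM.
  rewrite chi_coef_cst // -[mon q 0%MM]/(mps_cst _) rmorph_prod; apply: eq_bigr => i _.
  rewrite rmorphXn; congr (_ ^+ _); rewrite mpsDE mpsNE std_lift_cst /=.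
  by rewrite eq_sym mnm1_eq0 rmorph0 subr0.
rewrite !rmorphM /= mulrA divfK ?tofrac_eq0 // mulrC //.
Qed.

Lemma taylor_frob_deriv l x : mps_deriv l (taylor_frob x) =
  \sum_(i < n) @embK p n k W (mps_deriv l (psi (mpsX W i))) * taylor_frob (conn c x i).
Proof.
rewrite mps_derivM taylor_deriv (conn_frob hF) taylor_sum.
have -> : mps_deriv l (mpsC n (p%:R ^+ j)^-1 : {mps Ku[n]}) = 0.
  apply/mpsP => m; rewrite mps_derivE /= mnmD_eq0 mnm1_eq0 andbF /=.
  by rewrite mulr0n mul0rn.
rewrite mul0r add0r mulr_sumr; apply: eq_bigr => i _.
by rewrite taylorZ /taylor_frob mulrCA.
Qed.

(* Both sides satisfy the same differential equation, so the expansion at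
   t = 0, provided by chi, propagates to all coefficients. *)
Lemma taylor_subst x : is_subst psi (taylor x) (taylor_frob x).
Proof.
move=> m; elim/mnm_rec: m x => [|m l IH] x; first exact: taylor_frob_cst.
rewrite mps_coefS.
have ml0 : ((m l).+1%:R : Ku) != 0 by apply: (frac_nat_neq0 hp).
pose g i := mps_deriv l (psi (mpsX W i)).
(* The i-th term of the chain rule d_l psi(f) = sum_i d_l(psi(t_i)) psi(d_i f), for f = taylor x, at
   index m. *)
pose w i q := frobK (taylor (conn c x i) q) * ((g i * mon q) m)%:F.
have hw i : has_sum (fun N (y : Ku) => exists v : W, y = (p%:R ^+ N * v)%:F) (w i)
    ((@embK p n k W (g i) * taylor_frob (conn c x i)) m).
  rewrite mpsME.
  pose u (q : 'X_{1..n < (mdeg m).+1}) q' := (g i q)%:F *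
    (frobK (taylor (conn c x i) q') * (mon q' (m - q)%MM)%:F).
  pose s (q : 'X_{1..n < (mdeg m).+1}) :=
    (g i q)%:F * taylor_frob (conn c x i) (m - q)%MM.
  have hu (q : 'X_{1..n < (mdeg m).+1}) : (q <= m)%MM ->
      has_sum (fun N (y : Ku) => exists v : W, y = (p%:R ^+ N * v)%:F) (u q) (s q).
    by move=> _; apply: hsumZ; apply: IH; apply: mdegB.
  have := hsum_sum (index_enum _) hu.
  congr (has_sum _ _ _); apply/funext => q; rewrite /w mpsME rmorph_sum mulr_sumr.
  by apply: eq_bigr => q' _; rewrite rmorphM mulrCA.
(* The coefficient of d_i f at q - U_(i) is q_i f_q, so shifting brings every term back to the index
   q of f. *)
have hs := hsum_sum (index_enum _) (P := xpredT) (fun i _ => hsum_shift i (hw i)).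
have := hsumZ ((m l).+1%:R^-1) hs.
rewrite taylor_frob_deriv mps_sumE; congr (has_sum _ _ _); apply/funext => q.
have -> : (mon q (m + U_(l))%MM)%:F = (m l).+1%:R^-1 * (mps_deriv l (mon q) m)%:F :> Ku.
  by apply: (mulfI ml0); rewrite mulVKf // mps_derivE rmorphMn; apply: mulr_natl.
rewrite [RHS]mulrCA; congr (_ * _); rewrite mps_deriv_prodX mps_sumE rmorph_sum mulr_sumr.
apply: eq_bigr => i _; rewrite mpsMnE rmorphMn mulrnAr.
case: posnP => [->|qi]; first by rewrite mulr0n.
have qE : (q - U_(i) + U_(i) = q)%MM by rewrite submK // lep1mP -lt0n.
rewrite /w -taylor_deriv mps_derivE qE -[_ *+ (_ i).+1]mulr_natl frobKM // frobK_nat //.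
rewrite -[in RHS]mulr_natl mulrA; congr (_ * _ * _%:F).
  by rewrite mnmBE mnm1E eqxx subn1 prednK.
congr (mpscoef _ m); rewrite mulrC; congr (_ * _); apply: eq_bigr => r _.
by rewrite mnmBE mnm1E eq_sym.
Qed.

End OneFunctional.
End Taylor.

(** * Construction of the matrix of canonical coordinates *)

Section CanonicalCoordinates.
Variables (p n : nat) (k : closedFieldType).
Hypothesis hp : p \in [pchar k].
Variable W : witt_ring p k.
Local Notation A := {mps W[n]}.
Local Notation Ku := {fraction W}.
Local Notation sigma := (wfrob W).
Local Notation std := (std_lift n hp W).
Variables (H : lmodType A) (c : fcrystal_data H).
Hypothesis hF : is_fcrystal c.
Variables (I : finType) (b : I -> H) (lv : I -> nat).
Hypothesis hb : is_basis b.
Hypothesis frob_dvd : forall a i, pow_dvd p (lv a) (coord hb (frob c std (b a)) i).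
Hypothesis frob_top : forall a i, (lv a <= lv i)%N ->
  coord hb (frob c std (b a)) i = p%:R ^+ lv a * (i == a)%:R.
Hypothesis conn_top : forall a l i, (lv a <= lv i)%N -> coord hb (conn c (b a) l) i = 0.

(** The first derivative of [b a] has coordinates only in levels below lv a, and this span is stable
    under the connection. *)
Lemma conn_iter_top m a i : m != 0%MM -> (lv a <= lv i)%N ->
  coord hb (conn_iter (conn c) m (b a)) i = 0.
Proof.
elim/mnm_rec: m i => [i|m l _ i _ ai]; first by rewrite eqxx.
rewrite conn_iterS; last exact: (connC hF).
pose Q x := forall i, (lv a <= lv i)%N -> coord hb x i = 0.
suff : Q (conn_iter (conn c) m (conn c (b a) l)) by apply.
apply: (conn_iter_stable (P := Q)) => [x r Qx d ad|d]; last exact: conn_top.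
have -> : conn c x r = \sum_e conn c (coord hb x e *: b e) r.
  rewrite {1}[x](coord_sum hb); apply: (big_morph (fun y => conn c y r)).
    by move=> y z; apply: (connD hF).
  by apply: (addrI (conn c 0 r)); rewrite -(connD hF) !addr0.
rewrite coord_bigsum big1 // => e _; rewrite (connZ hF) coordP coordZ.
have [ae|ea] := leqP (lv a) (lv e).
  by rewrite Qx // raddf0 !mul0r addr0.
by rewrite conn_top ?(leq_trans (ltnW ea)) // mulr0 addr0 coord_basis;
  case: eqP ea => [<-|_]; rewrite ?ltnNge ?ad ?mulr0.
Qed.

Lemma canonical_coordinates : exists T : I -> I -> {mps Ku[n]},
  [/\ forall a a', (lv a' <= lv a)%N -> T a a' = (a == a')%:R,
      forall a a', exists w : W, T a a' 0%MM = (p%:R ^+ (lv a' - lv a) * w)%:F,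
      forall l a a', mps_deriv l (T a a') =
        \sum_i T a i * @embK p n k W (coord hb (conn c (b a') l) i) &
      forall psi a a', exists2 S, is_subst psi (T a a') S &
        mpsC n (p%:R ^+ lv a) * S =
        \sum_i T a i * @embK p n k W (coord hb (frob c psi (b a')) i)].
Proof.
(* Dividing column a of Frobenius at t = 0 by p^(lv a) leaves a block unipotent matrix M. *)
have exM i a : exists v : W, coord hb (frob c std (b a)) i 0%MM = p%:R ^+ lv a * v.
  exact: (rmorph_pow_dvd (@mps_cst n W) (frob_dvd a i)).
pose M i a := sval (cid (exM i a)).
have ME i a : coord hb (frob c std (b a)) i 0%MM = p%:R ^+ lv a * M i a.
  exact: svalP (cid (exM i a)).
have [|C [C1 Cd CM]] := @unipotent_frob p k W I lv M.
  move=> i a ai; apply: (mulfI (witt_pX_neq0 W (lv a))); rewrite -ME frob_top //.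
  by rewrite -[LHS]/(mps_cst _) rmorphM rmorphXn !rmorph_nat.
(* Row a of C, applied to coordinates at t = 0; the relation between C and M makes it an
   eigenfunctional of Frobenius. *)
pose ell a x := \sum_i C a i * coord hb x i 0%MM.
have ellD a x y : ell a (x + y) = ell a x + ell a y.
  by rewrite -big_split; apply: eq_bigr => i _; rewrite coordD mpsDE mulrDr.
have ellZ a (f : A) x : ell a (f *: x) = f 0%MM * ell a x.
  by rewrite mulr_sumr; apply: eq_bigr => i _; rewrite coordZ mpsM0E mulrCA.
have ell_frob a x : ell a (frob c std x) = p%:R ^+ lv a * sigma (ell a x).
  rewrite rmorph_sum mulr_sumr.
  have coF i : coord hb (frob c std x) i 0%MM =
      \sum_e sigma (coord hb x e 0%MM) * (p%:R ^+ lv e * M i e).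
    rewrite {1}[x](coord_sum hb) (frob_sum hF) coord_bigsum mps_sumE; apply: eq_bigr => e _.
    by rewrite (frobZ hF) coordZ mpsM0E std_lift_cst ME.
  transitivity (\sum_e sigma (coord hb x e 0%MM) * \sum_i C a i * (p%:R ^+ lv e * M i e)).
    rewrite /ell; under eq_bigr do rewrite coF mulr_sumr.
    rewrite exchange_big; apply: eq_bigr => e _; rewrite mulr_sumr.
    by apply: eq_bigr => i _; rewrite mulrCA.
  by apply: eq_bigr => e _; rewrite CM rmorphM mulrCA; congr (_ * _); apply: mulrC.
have ell_b a a' : ell a (b a') = C a a'.
  rewrite /ell (bigD1 a') //= coord_basis eqxx mps1E eqxx mulr1 big1 ?addr0 // => i.
  by move=> /negPf ia; rewrite coord_basis ia mps0E mulr0.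
pose T a a' := taylor c (ell a) (b a').
(* By A-linearity, an identity about series of vectors of H becomes a matrix identity in T. *)
have T_lin a x : taylor c (ell a) x = \sum_i T a i * @embK p n k W (coord hb x i).
  rewrite {1}[x](coord_sum hb) (taylor_sum hF (ellD a)); apply: eq_bigr => i _.
  by rewrite (taylorZ hp hF (ellD a) (ellZ a)) mulrC.
exists T; split=> [a a' le_aa'|a a'|l a a'|psi a a'].
- apply/mpsP => m; have [->|m0] := eqVneq m 0%MM.
    rewrite taylor_cst ell_b C1 // rmorph_nat mpsMnE mps1E eqxx.
    by case: (a == a').
  rewrite mpsMnE mps1E (negPf m0) mul0rn /=.
  suff -> : ell a (conn_iter (conn c) m (b a')) = 0 by rewrite rmorph0 mul0r.
  (* In levels above lv a the coordinates of the derivative vanish; in the others C leaves only i =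
     a, where the coordinate vanishes too. *)
  rewrite /ell big1 // => i _; have [ai|ia] := ltnP (lv a) (lv i).
    by rewrite conn_iter_top ?mps0E ?mulr0 // (leq_trans le_aa') // ltnW.
  rewrite C1 //; case: eqP => [<-|]; last by rewrite mul0r.
  by rewrite conn_iter_top // mps0E mulr0.
- have [v vE] := Cd a a'; exists v; by rewrite taylor_cst ell_b vE.
- by rewrite (taylor_deriv hp hF) T_lin.
exists (taylor_frob c (ell a) (lv a) psi (b a')).
  exact: (taylor_subst hF (ellD a) (ellZ a) (ell_frob a)).
rewrite -T_lin /taylor_frob mulrA; set u := mpsC n _; set v := mpsC n _.
suff -> : u * v = 1 by rewrite mul1r.
apply/mpsP => m; rewrite mpsCME /= mulrnAr divff ?mps1E //.
by rewrite -(rmorph_nat (@FracField.tofrac W)) -rmorphXn tofrac_eq0 witt_pX_neq0.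
Qed.

End CanonicalCoordinates.

(** * From canonical coordinates to block matrices *)

Theorem theorem1p8 (p n N : nat) (k : closedFieldType) (hp : p \in [pchar k])
    (W : witt_ring p k)
    (H : lmodType {mps W[n]}) (c : fcrystal_data H) (hF : is_fcrystal c)
    (phi0 : frob_lift n W)
    (hlevel : level_le c phi0 N) (hN : (N < p)%N)
    (hord : is_ordinary c phi0)
    (U : nat -> H -> Prop) (hU : is_ordinary_filtration c phi0 U)
    (Fil : nat -> H -> Prop) (hFil : is_hodge_filtration c phi0 Fil)
    (hdiv : is_divisible c Fil N) :
  let Hi (i : 'I_N.+1) (x : H) := U i x /\ Fil i x in
  is_direct_sum Hi /\
  exists h : 'I_N.+1 -> nat,
    (forall i, has_rank (Hi i) (h i)) /\
    exists (e : forall i, 'I_(h i) -> H)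
           (tau : forall i j, 'M[{mps {fraction W}[n]}]_(h i, h j)),
      let b (a : 'I_(\sum_i h i)) : H := e (tagnat.sig1 a) (tagnat.sig2 a) in
      let T : 'M[{mps {fraction W}[n]}]_(\sum_i h i) :=
        \mxblock_(i < N.+1, j < N.+1) tau i j in
      let P : 'M[{mps {fraction W}[n]}]_(\sum_i h i) :=
        \mxdiag_(i < N.+1) (p%:R ^+ i)%:M in
      [/\ is_basis b /\ (forall i m, Hi i (e i m)),
          forall a a', over_Wp (T a a'),
          [/\ forall i j : 'I_N.+1, (j < i)%N -> tau i j = 0,
              forall i, tau i i = 1%:M
            & forall i j : 'I_N.+1, (i <= j)%N -> forall a a',
                exists w : W,
                  (tau i j a a') 0%MM = (p%:R ^+ (j - i) * w)%:F],
          forall l : 'I_n, exists M : 'M[{mps W[n]}]_(\sum_i h i),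
            is_matrix_of b (fun x => conn c x l) M /\
            map_mx (@embK p n k W) M =
              invmx T *m map_mx (mps_deriv l) T
        & forall psi : frob_lift n W,
            exists (psiT : 'M[{mps {fraction W}[n]}]_(\sum_i h i))
                   (M : 'M[{mps W[n]}]_(\sum_i h i)),
            [/\ forall a a', is_subst psi (T a a') (psiT a a'),
                is_matrix_of b (frob c psi) M
              & map_mx (@embK p n k W) M = invmx T *m P *m psiT]].
Proof.
move=> Hi; have [FilT FilS _ _ FilD] := hFil.
have Us := prev_sub hU; have Fs := Fil_submod hFil; have Ule := prev_le hU.
have U0 : forall x, prev_step U 0 x -> x = 0 by [].
have UN := prev_all hp hF hlevel hU.
have UFsum := prev_Fil_sum hp hF hord hU hFil.
have UFdisj := prev_Fil_disj hF hord hU hFil.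
have dsum : is_direct_sum Hi := piece_direct_sum Us Fs Ule U0 UN UFsum UFdisj.
split=> //.
have ex (i : 'I_N.+1) := piece_flat_basis hp hF hord hU hFil i.
pose h (i : 'I_N.+1) := sval (cid (ex i)).
pose e i : 'I_(h i) -> H := sval (cid (svalP (cid (ex i)))).
have eP i : [/\ is_basis_of (Hi i) (@e i),
    forall m, prev_step U i (frob c (std_lift n hp W) (e i m) - p%:R ^+ i *: e i m) &
    forall m l, prev_step U i (conn c (e i m) l)] := svalP (cid (svalP (cid (ex i)))).
have he i : is_basis_of (Hi i) (@e i) by case: (eP i).
exists h; split=> [i|].
  split; first exact: (piece_sub Us Fs).
  by exists (@e i).
pose b (a : 'I_(\sum_i h i)) : H := e _ (tagnat.sig2 a).
pose lv (a : 'I_(\sum_i h i)) : nat := tagnat.sig1 a.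
have hb : is_basis b := piece_basis Us Fs Ule U0 UN UFsum UFdisj he.
(* Errors lying in U_(i-1) become vanishing coordinates, which yields the triangular shape of the
   connection and of Frobenius. *)
have top a x i : prev_step U (lv a) x -> (lv a <= lv i)%N -> coord hb x i = 0.
  move=> Px ai; apply: (piece_coord_eq0 Us Fs Ule U0 UFsum he) Px ai.
  exact: ltnW (ltn_ord _).
have [|||T [T1 T0 TD TF]] := @canonical_coordinates p n k hp W H c hF _ b lv hb.
(* Divisibility is assumed for one lift and used for t |-> t^p; the hypothesis N < p enters here. *)
- move=> a i; apply: (iffLR (in_pow_coord hb p (lv a) _)).
  apply: (divisible_all_lifts hp hF hN FilS FilT FilD hdiv); first by rewrite -ltnS ltn_ord.
  by have [/(_ (tagnat.sig2 a))[]] := he (tagnat.sig1 a).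
- move=> a i ai; have [_ /(_ (tagnat.sig2 a)) hFe _] := eP (tagnat.sig1 a).
  have := top _ _ _ hFe ai; rewrite coordB coordZ coord_basis => /eqP.
  by rewrite subr_eq0 => /eqP.
- move=> a l i ai; have [_ _ hDe] := eP (tagnat.sig1 a).
  exact: top (hDe _ _) ai.
pose Tm : 'M[{mps {fraction W}[n]}]_(\sum_i h i) := \matrix_(a, a') T a a'.
exists e, (submxblock Tm); rewrite submxblockK -/b.
have uT : Tm \in unitmx.
  (* T is upper triangular with unit diagonal, as the numbering of the basis is monotone in the
     block index; transposing suits [det_trig], which treats lower triangular matrices. *)
  rewrite unitmxE -det_tr det_trig; last first.
    apply/is_trig_mxP => a a' aa'; rewrite !mxE T1.
      by rewrite -val_eqE /= gtn_eqF.
    exact: tagnat.le_sig1 (ltnW aa').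
  rewrite big1 ?unitr1 // => a _; by rewrite !mxE T1 // eqxx.
split=> [|a a'||l|psi].
- by split=> // i m; case: (he i).
- by rewrite mxE => m; apply: frac_wittP.
- split=> [i j ji|i|i j ij a a'].
  + apply/matrixP => a a'; rewrite !mxE T1 /lv ?tagnat.Rank1K ?(ltnW ji) //.
    case: eqP => // /(congr1 (@tagnat.sig1 _ h)); rewrite !tagnat.Rank1K => ij.
    by rewrite ij ltnn in ji.
  + apply/matrixP => a a'; rewrite !mxE T1 // /lv ?tagnat.Rank1K //.
    by rewrite -val_eqE tagnat.eq_Rank eqxx.
  have [w wE] := T0 (tagnat.Rank i a) (tagnat.Rank j a').
  by exists w; rewrite !mxE wE /lv !tagnat.Rank1K.
- exists (\matrix_(i, j) coord hb (conn c (b j) l) i); split.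
    by move=> j; rewrite {1}[conn _ _ _](coord_sum hb); apply: eq_bigr => i _; rewrite mxE.
  (* Multiplying by T reduces the claim to T M = dT, which is [TD]. *)
  apply: (canRL (mulKmx uT)); apply/matrixP => a a'; rewrite !mxE TD.
  by apply: eq_bigr => i _; rewrite !mxE.
pose S a a' := s2val (cid2 (TF psi a a')).
have [Ssub SE] : (forall a a', is_subst psi (T a a') (S a a')) /\ (forall a a',
    mpsC n (p%:R ^+ lv a) * S a a' =
    \sum_i T a i * @embK p n k W (coord hb (frob c psi (b a')) i)).
  split=> a a'; first exact: s2valP (cid2 (TF psi a a')).
  exact: s2valP' (cid2 (TF psi a a')).
exists (\matrix_(a, a') S a a'), (\matrix_(i, j) coord hb (frob c psi (b j)) i).
split.
- by move=> a a'; rewrite !mxE.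
- by move=> j; rewrite {1}[frob _ _ _](coord_sum hb); apply: eq_bigr => i _; rewrite mxE.
rewrite -mulmxA; apply: (canRL (mulKmx uT)).
(* As an ordinary diagonal matrix, P scales row a by p^(lv a), which is the shape of [SE]. *)
have -> : \mxdiag_(i < N.+1) (p%:R ^+ i)%:M =
    diag_mx (\row_a p%:R ^+ lv a) :> 'M[{mps {fraction W}[n]}]_(\sum_i h i).
  transitivity (\mxdiag_(i < N.+1)
    diag_mx (const_mx (p%:R ^+ i) : 'rV[{mps {fraction W}[n]}]_(h i))).
    by apply: eq_mxdiag => i; rewrite diag_const_mx.
  by rewrite -diag_mxrow; congr diag_mx; apply/rowP => a; rewrite !mxE.
apply/matrixP => a a'; rewrite mul_diag_mx !mxE -mpsC_natX SE.
by apply: eq_bigr => i _; rewrite !mxE.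
Qed.
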